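(* Let $H=H_{2\times 2\times 2}$ be the $2\times 2\times 2$ honeycomb graph. Then the perfect matching complex $\mathcal{M}_p(H)$ is homotopy equivalent to $S^3\vee S^3$.
   Context: For a finite simple graph $G$, a perfect matching is a set of pairwise vertex-disjoint edges covering every vertex. The perfect matching complex $\mathcal{M}_p(G)$ is the simplicial complex on vertex set $E(G)$ whose faces are the subsets of perfect matchings of $G$. The honeycomb graph $H_{2\times 2\times 2}$ is the planar graph formed by seven hexagonal cells of the hexagonal lattice: one central hexagon together with the six hexagons sharing an edge with it (a hexagon-shaped region with two hexagons along each side); its vertices and edges are those of the seven cells (24 vertices, 30 edges). Its perfect matchings are in bijection with plane partitions fitting in a $2\times 2$ array with entries at most $2$. *)

(* Defs.v *)
From mathcomp Require Import all_boot all_order all_algebra.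
From mathcomp Require Import all_classical all_reals all_analysis.
From mathcomp Require Import wedge_sigT.

Set Implicit Arguments.
Unset Strict Implicit.
Unset Printing Implicit Defensive.

Import Order.TTheory GRing.Theory Num.Theory.
Import numFieldNormedType.Exports.

Local Open Scope classical_set_scope.
Local Open Scope ring_scope.

Record sgraph := SGraph {
  vertex :> finType;
  adj : rel vertex;
  adj_sym : symmetric adj;
  adj_irr : irreflexive adj }.

Definition edges (G : sgraph) : {set {set G}} :=
  [set e : {set G} |
    [exists x : G, exists y : G, adj x y && (e == [set x; y])]]%SET.

Notation edge G := {e : {set vertex G} | e \in edges G}.

Definition perfect_matching (G : sgraph) (M : {set edge G}) : bool :=
  [forall e in M, forall f in M, (e != f) ==> [disjoint val e & val f]]
  && [forall v : G, exists e in M, v \in val e].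

(* The empty set may be a face, and an element of
   the vertex set need not be a face. *)

Record simplicial_complex (V : finType) := SimplicialComplex {
  faces : {set {set V}};
  faces_down : forall s t : {set V}, t \subset s -> s \in faces -> t \in faces }.

Definition perfect_matching_faces (G : sgraph) : {set {set edge G}} :=
  [set s : {set edge G} |
    [exists M : {set edge G}, perfect_matching M && (s \subset M)]]%SET.

Lemma perfect_matching_faces_down (G : sgraph) (s t : {set edge G}) :
  t \subset s -> s \in perfect_matching_faces G ->
  t \in perfect_matching_faces G.
Proof.
move=> ts; rewrite !finset.inE => /existsP[M /andP[pM sM]].
by apply/existsP; exists M; rewrite pM (fintype.subset_trans ts sM).
Qed.

Definition perfect_matching_complex (G : sgraph) : simplicial_complex (edge G) :=
  SimplicialComplex (@perfect_matching_faces_down G).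

(* As the complex is finite,
   the topology is the one induced by the product topology on functions from
   the vertex set to R. *)
Definition barycentric (R : realType) (V : finType) (K : simplicial_complex V) :
    set {ptws V -> R} :=
  [set w : V -> R | [/\ forall v, 0 <= w v, \sum_v w v = 1 &
                        [set v | w v != 0]%SET \in faces K]].

Definition realization (R : realType) (V : finType) (K : simplicial_complex V) :
    topologicalType := [the topologicalType of set_type (@barycentric R V K)].
Arguments realization R {V} K.

(* Points of the triangular lattice have coordinates in
   int * int, so that the six neighbours of 0 are the hex_dirs; the hexagonal
   lattice is obtained by removing the points (x, y) with x = y mod 3, which
   are the centres of the hexagonal cells. A cell is given by its centre, and
   its six vertices are the neighbours of the centre. *)

Definition hex_dirs : seq (int * int) :=
  [:: (1, 0); (0, 1); (-1, 1); (-1, 0); (0, -1); (1, -1)].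

Definition hex_cell (c : int * int) : seq (int * int) :=
  [seq c + d | d <- hex_dirs].

Definition honeycomb_centres : seq (int * int) :=
  [:: (0, 0); (1, 1); (-1, 2); (-2, 1); (-1, -1); (1, -2); (2, -1)].

Definition honeycomb_vertices : seq (int * int) :=
  undup (flatten [seq hex_cell c | c <- honeycomb_centres]).

Definition honeycomb_adj : rel (seq_sub honeycomb_vertices) :=
  fun u v => (val v - val u \in hex_dirs) &&
    has (fun c => (val u \in hex_cell c) && (val v \in hex_cell c))
      honeycomb_centres.

Lemma honeycomb_adj_sym : symmetric honeycomb_adj.
Proof.
have dirsN (d : int * int) : (- d \in hex_dirs) = (d \in hex_dirs).
  have imp (e : int * int) : e \in hex_dirs -> - e \in hex_dirs.
    by rewrite !inE => /or4P[|||/or3P[||]] /eqP->; rewrite /= ?eqxx ?orbT.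
  by apply/idP/idP => /imp; rewrite ?opprK.
move=> u v; rewrite /honeycomb_adj -dirsN opprB; congr (_ && _).
by apply: eq_has => c /=; rewrite andbC.
Qed.

Lemma honeycomb_adj_irr : irreflexive honeycomb_adj.
Proof. by move=> u; rewrite /honeycomb_adj subrr. Qed.

Definition honeycomb222 : sgraph := SGraph honeycomb_adj_sym honeycomb_adj_irr.

Lemma card_honeycomb222 : #|honeycomb222| = 24%N.
Proof. by rewrite card_seq_sub ?undup_uniq //; vm_compute. Qed.

Definition homotopic (R : realType) (X Y : topologicalType) (f g : X -> Y) :=
  exists H : X * R -> Y,
    [/\ {within [set: X] `*` `[0, 1], continuous H},
        forall x, H (x, 0) = f x & forall x, H (x, 1) = g x].

Definition homotopy_equivalent (R : realType) (X Y : topologicalType) :=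
  exists (f : X -> Y) (g : Y -> X),
    [/\ continuous f, continuous g,
        homotopic R (g \o f) idfun & homotopic R (f \o g) idfun].

(* The norm of 'rV[R]_n.+1 is the sup norm, hence the explicit sum of squares. *)
Definition sphere (R : realType) (n : nat) : set 'rV[R]_n.+1 :=
  [set x : 'rV[R]_n.+1 | \sum_i x 0 i ^+ 2 = 1].
Arguments sphere : clear implicits.

Lemma sphere_delta (R : realType) (n : nat) :
  (delta_mx 0 0 : 'rV[R]_n.+1) \in sphere R n.
Proof.
apply/mem_set; rewrite /sphere /= (bigD1 ord0) //= !mxE !eqxx expr1n big1 ?addr0 //.
by move=> i i0; rewrite !mxE (negbTE i0) andbF expr0n.
Qed.

Definition sphere_point (R : realType) (n : nat) : sphere R n :=
  exist _ (delta_mx 0 0) (sphere_delta R n).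

Definition sphere_wedge (R : realType) (n : nat) : topologicalType :=
  wedge (fun _ : bool => sphere_point R n).

(* Main.v *)
(* Number the sides of the outer boundary of H by i mod 6. A perfect matching contains, in
   the i-th outer cell, either the middle outer edge (call it [outer]) or its two neighbours;
   these neighbours and the spokes of H are dominated by [outer] edges, so the complex retracts
   onto its restriction to the six [outer] edges a_i and the six edges b_i of the central
   hexagon ([inner]). Collapsing the free faces {b_i, b_(i+3)} leaves a union X_0 \cup X_1
   according to the parity of the i for which b_i occurs, with X_0 \cap X_1 the simplex on the
   a_i. Finally X_k is the octahedral 2-sphere on the a_i, b_i with i of parity k, joined with
   the simplex on the other a_i on one side and filled by a full simplex on the other side:
   this is S^3, the simplex on all the a_i being pushed to the base point.
   The intermediate space [octahedral_cone] drops the normalization of barycentric coordinates: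
   it is the open cone on X_0 \cup X_1. *)

Require Import Defs.
From mathcomp Require Import all_boot all_order all_algebra.
From mathcomp Require Import all_classical all_reals all_analysis.
From mathcomp Require Import wedge_sigT.
From mathcomp Require Import lra.

Set Implicit Arguments.
Unset Strict Implicit.
Unset Printing Implicit Defensive.

Import Order.TTheory GRing.Theory Num.Theory.
Import numFieldNormedType.Exports.

Local Open Scope classical_set_scope.
Local Open Scope ring_scope.

(** * Points of subsets and continuity at a point *)

Definition set_elt (P : Type) (A : set P) (x : P) (Ax : A x) : A :=
  exist (fun x => x \in A) x (mem_set Ax).

Lemma set_type_inj (P : Type) (A : set P) (x y : A) :
  set_val x = set_val y -> x = y.
Proof. by case: x y => [x Ax] [y Ay] /= xy; apply: eq_exist. Qed.

Section ContinuityAtAPoint.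
Context (R : realType) (T : topologicalType).
Implicit Types (f g : T -> R) (x : T).

Lemma continuous_at_cst (U : topologicalType) (c : U) x :
  continuous_at x (fun=> c).
Proof. exact: cvg_cst. Qed.

Lemma continuous_at_add f g x : continuous_at x f ->
  continuous_at x g -> continuous_at x (fun y => f y + g y).
Proof. exact: cvgD. Qed.

Lemma continuous_at_opp f x : continuous_at x f ->
  continuous_at x (fun y => - f y).
Proof. exact: cvgN. Qed.

Lemma continuous_at_mul f g x : continuous_at x f ->
  continuous_at x g -> continuous_at x (fun y => f y * g y).
Proof. exact: cvgM. Qed.

Lemma continuous_at_inv f x : f x != 0 -> continuous_at x f ->
  continuous_at x (fun y => (f y)^-1).
Proof. exact: cvgV. Qed.

Lemma continuous_at_max f g x : continuous_at x f ->
  continuous_at x g -> continuous_at x (fun y => Num.max (f y) (g y)).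
Proof. by move=> cf cg; apply: (@continuous_max R T f g x). Qed.

Lemma continuous_at_min f g x : continuous_at x f ->
  continuous_at x g -> continuous_at x (fun y => Num.min (f y) (g y)).
Proof. by move=> cf cg; apply: (@continuous_min R T f g x). Qed.

Lemma continuous_at_sum (I : Type) (r : seq I) (P : pred I) (F : I -> T -> R) x :
  (forall i, continuous_at x (F i)) ->
  continuous_at x (fun y => \sum_(i <- r | P i) F i y).
Proof.
move=> cF; elim: r => [|i r IH].
  rewrite (_ : (fun _ => _) = fun=> 0); first exact: continuous_at_cst.
  by apply/funext => y; rewrite big_nil.
case Pi : (P i).
  rewrite (_ : (fun _ => _) = fun y => F i y + \sum_(i <- r | P i) F i y).
    exact: continuous_at_add.
  by apply/funext => y; rewrite big_cons Pi.
rewrite (_ : (fun _ => _) = fun y => \sum_(i <- r | P i) F i y) //.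
by apply/funext => y; rewrite big_cons Pi.
Qed.

Lemma continuous_at_sqrt f x : continuous_at x f ->
  continuous_at x (fun y => Num.sqrt (f y)).
Proof.
by move=> cf; apply: (@continuous_comp _ _ _ f Num.sqrt) => //; exact: sqrt_continuous.
Qed.

Lemma continuous_at_ptws (V : Type) (f : T -> {ptws V -> R}) x :
  (forall v, continuous_at x (fun y => f y v)) -> continuous_at x f.
Proof.
move=> cf; apply/cvg_sup => v U [_ [/= [W oW <-] Wx WU]].
rewrite nbhs_simpl /=.
apply: (filterS (fun y => WU (f y))); apply: (cf v).
by apply: open_nbhs_nbhs.
Qed.

Lemma continuous_at_matrix m n (f : T -> 'M[R]_(m, n)) x :
  (forall i j, continuous_at x (fun y => f y i j)) ->
  continuous_at x f.
Proof.
move=> cf U [P nP PU]; rewrite nbhs_simpl /=.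
apply: (filterS (fun y => PU (f y))) => /=.
apply: filter_forall => i; apply: filter_forall => j.
exact: (cf i j _ (nP i j)).
Qed.

Lemma continuous_at_pair (U V : topologicalType) (f : T -> U) (g : T -> V) x :
  continuous_at x f -> continuous_at x g ->
  continuous_at x (fun y => (f y, g y)).
Proof. by move=> cf cg; apply: cvg_pair. Qed.

Lemma continuous_at_comp (U V : topologicalType) (f : T -> U) (g : U -> V) x :
  continuous_at x f -> continuous_at (f x) g ->
  continuous_at x (fun y => g (f y)).
Proof. exact: continuous_comp. Qed.

Lemma continuous_at_set_type (P : topologicalType) (A : set P) (f : T -> A) x :
  continuous_at x (fun y => set_val (f y)) -> continuous_at x f.
Proof.
move=> cf U [_ [/= [W oW <-] Wx WU]]; rewrite nbhs_simpl /=.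
apply: (filterS (fun y => WU (f y))); apply: cf.
by apply: open_nbhs_nbhs.
Qed.

(** Each piece need only be continuous at the points of its own closed set, as is the case for
    radial projections, which are continuous only away from 0. *)
Lemma continuous_at_paste (U : topologicalType) (A B : set T) (f g h : T -> U) :
  closed A -> closed B -> (forall x, A x \/ B x) ->
  (forall x, A x -> continuous_at x f) ->
  (forall x, B x -> continuous_at x g) ->
  {in A, f =1 h} -> {in B, g =1 h} -> continuous h.
Proof.
move=> cA cB AB cf cg fh gh; apply: (iffRL (continuous_subspace_setT h)).
have -> : [set: T] = A `|` B by apply/seteqP; split => // x _; exact: AB.
apply: withinU_continuous => //.
- apply: subspace_eq_continuous fh _; apply/subspace_continuousP => x Ax.
  by apply: cvg_within_filter; apply: cf.
- apply: subspace_eq_continuous gh _; apply/subspace_continuousP => x Bx.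
  by apply: cvg_within_filter; apply: cg.
Qed.

End ContinuityAtAPoint.

Lemma continuous_ptws_eval (R : realType) (V : eqType) (v : V) :
  continuous (fun w : {ptws V -> R} => w v).
Proof. exact: (@proj_continuous V (fun _ => R) v). Qed.

(** * Homotopies parametrized by all real times *)

Section Homotopy.
Context (R : realType).
Implicit Types X Y Z : topologicalType.

(** Freezes time outside [0, 1], so that a formula staying in a subset only for times in [0, 1]
    still gives a homotopy for all real times. *)
Definition clip (t : R) : R := Num.max 0 (Num.min t 1).

Lemma clip_itv t : 0 <= clip t <= 1.
Proof. by rewrite /clip le_max lexx /= ge_max ge_min lexx orbT ler01. Qed.

Lemma clip_id t : 0 <= t <= 1 -> clip t = t.
Proof. by case/andP=> t0 t1; rewrite /clip (min_idPl t1) (max_idPr t0). Qed.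

Lemma continuous_at_clip (T : topologicalType) (f : T -> R) (x : T) :
  continuous_at x f -> continuous_at x (fun y => clip (f y)).
Proof.
move=> cf; apply: continuous_at_max; first exact: continuous_at_cst.
by apply: continuous_at_min => //; exact: continuous_at_cst.
Qed.

(** Continuity on all of [X * R] lets homotopies be composed and pasted without subspace
    topologies. *)
Definition globally_homotopic X Y (f g : X -> Y) :=
  exists H : X * R -> Y,
    [/\ continuous H, forall x, H (x, 0) = f x & forall x, H (x, 1) = g x].

Lemma globally_homotopic_homotopic X Y (f g : X -> Y) :
  globally_homotopic f g -> homotopic R f g.
Proof.
by case=> H [cH H0 H1]; exists H; split=> //; apply: continuous_subspaceT.
Qed.

Lemma globally_homotopic_trans X Y (f g h : X -> Y) :
  globally_homotopic f g -> globally_homotopic g h -> globally_homotopic f h.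
Proof.
move=> [F [cF F0 F1]] [G [cG G0 G1]].
pose A : set (X * R) := [set z | z.2 <= 2^-1].
pose B : set (X * R) := [set z | 2^-1 <= z.2].
have csnd (z : X * R) : continuous_at z (fun z : X * R => z.2) by exact: cvg_snd.
have cfst (z : X * R) : continuous_at z (fun z : X * R => z.1) by exact: cvg_fst.
exists (fun z => if z.2 <= 2^-1 then F (z.1, 2 * z.2) else G (z.1, 2 * z.2 - 1)).
split; last 2 first.
- by move=> x /=; rewrite invr_ge0 ler0n mulr0 F0.
- move=> x /=; rewrite leNgt invf_lt1 ?ltr1n //=.
  by rewrite (_ : 2 * 1 - 1 = 1 :> R) ?G1 //; lra.
apply: (@continuous_at_paste _ _ A B (fun z => F (z.1, 2 * z.2))
  (fun z => G (z.1, 2 * z.2 - 1))).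
- apply: (@closed_comp _ _ (fun z : X * R => z.2) [set t | t <= 2^-1]).
    by move=> z _; exact: csnd.
  exact: closed_le.
- apply: (@closed_comp _ _ (fun z : X * R => z.2) [set t | 2^-1 <= t]).
    by move=> z _; exact: csnd.
  exact: closed_ge.
- by move=> z; rewrite /A /B /=; case: (leP z.2 2^-1) => [|/ltW]; [left|right].
- move=> z _; apply: (@continuous_at_comp _ _ _ (fun z : X * R => (z.1, 2 * z.2)) F); last exact: cF.
  apply: continuous_at_pair => //=; apply: continuous_at_mul => //.
  exact: continuous_at_cst.
- move=> z _; apply: (@continuous_at_comp _ _ _ (fun z : X * R => (z.1, 2 * z.2 - 1)) G); last exact: cG.
  apply: continuous_at_pair => //=; apply: continuous_at_add; last exact: continuous_at_cst.
  apply: continuous_at_mul => //; exact: continuous_at_cst.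
- by move=> z; rewrite inE /A /= => ->.
- move=> z; rewrite inE /B /= => zB; case: ifP => // zA.
  (* The closed halves overlap at time 1/2, where both branches equal [g]. *)
  have -> : z.2 = 2^-1 by apply/le_anti; rewrite zA zB.
  by rewrite divff ?pnatr_eq0 // subrr G0 F1.
Qed.

Lemma globally_homotopic_comp X Y Z (f f' : X -> Y) (g : Y -> Z) :
  continuous g -> globally_homotopic f f' ->
  globally_homotopic (g \o f) (g \o f').
Proof.
move=> cg [H [cH H0 H1]]; exists (g \o H); split=> [z|x|x] /=.
- by apply: continuous_comp; [exact: cH|exact: cg].
- by rewrite H0.
- by rewrite H1.
Qed.

Lemma globally_homotopic_precomp X Y Z (f : X -> Y) (g g' : Y -> Z) :
  continuous f -> globally_homotopic g g' ->
  globally_homotopic (g \o f) (g' \o f).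
Proof.
move=> cf [H [cH H0 H1]]; exists (fun z => H (f z.1, z.2)); split=> [z|x|x] //=.
apply: (@continuous_at_comp _ _ _ (fun z : X * R => (f z.1, z.2)) H); last exact: cH.
apply: continuous_at_pair => /=; last exact: cvg_snd.
apply: (@continuous_at_comp _ _ _ (fun z : X * R => z.1) f); last exact: cf.
exact: cvg_fst.
Qed.

Definition globally_homotopy_equivalent X Y :=
  exists (f : X -> Y) (g : Y -> X),
    [/\ continuous f, continuous g, globally_homotopic (g \o f) idfun &
        globally_homotopic (f \o g) idfun].

Lemma globally_homotopy_equivalentW X Y :
  globally_homotopy_equivalent X Y -> homotopy_equivalent R X Y.
Proof.
move=> [f [g [cf cg gf fg]]]; exists f, g.
by split=> //; exact: globally_homotopic_homotopic.
Qed.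

Lemma globally_homotopy_equivalent_trans X Y Z :
  globally_homotopy_equivalent X Y -> globally_homotopy_equivalent Y Z ->
  globally_homotopy_equivalent X Z.
Proof.
move=> [f [f' [cf cf' ff' f'f]]] [g [g' [cg cg' gg' g'g]]].
exists (g \o f), (f' \o g'); split.
- by move=> x; apply: continuous_comp; [exact: cf|exact: cg].
- by move=> x; apply: continuous_comp; [exact: cg'|exact: cf'].
- apply: globally_homotopic_trans ff'.
  apply: (@globally_homotopic_comp _ _ _ ((g' \o g) \o f) f f') => //.
  exact: (@globally_homotopic_precomp _ _ _ f (g' \o g) idfun).
- apply: globally_homotopic_trans g'g.
  apply: (@globally_homotopic_comp _ _ _ ((f \o f') \o g') g' g) => //.
  exact: (@globally_homotopic_precomp _ _ _ g' (f \o f') idfun).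
Qed.

(** Reduces a homotopy into a subset to an explicit formula in the ambient space that stays in the
    subset for times in [0, 1]. *)
Lemma globally_homotopic_into_set X (Q : topologicalType) (B : set Q)
    (f g : X -> B) (H : X -> R -> Q) :
  (forall x t, 0 <= t <= 1 -> B (H x t)) ->
  continuous (fun z : X * R => H z.1 z.2) ->
  (forall x, H x 0 = set_val (f x)) -> (forall x, H x 1 = set_val (g x)) ->
  globally_homotopic f g.
Proof.
move=> BH cH H0 H1.
exists (fun z => set_elt (BH z.1 _ (clip_itv z.2))).
split=> [z|x|x]; last 2 first.
- apply: set_type_inj; rewrite -H0; transitivity (H x (clip 0)) => //=.
  by rewrite clip_id ?lexx ?ler01.
- apply: set_type_inj; rewrite -H1; transitivity (H x (clip 1)) => //=.
  by rewrite clip_id ?lexx ?ler01.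
apply: continuous_at_set_type => /=.
apply: (@continuous_at_comp _ _ _ (fun z : X * R => (z.1, clip z.2))
  (fun z => H z.1 z.2)); last exact: cH.
apply: continuous_at_pair => /=; first exact: cvg_fst.
by apply: continuous_at_clip; exact: cvg_snd.
Qed.

Lemma continuous_line X (V : Type) (f g : X -> {ptws V -> R}) :
  (forall v, continuous (fun x => f x v)) ->
  (forall v, continuous (fun x => g x v)) ->
  continuous (fun z : X * R =>
    (fun v => (1 - z.2) * f z.1 v + z.2 * g z.1 v) : {ptws V -> R}).
Proof.
move=> cf cg z; apply: continuous_at_ptws => v.
have csnd : continuous_at z (fun z : X * R => z.2) by exact: cvg_snd.
apply: continuous_at_add; apply: continuous_at_mul => //.
- apply: continuous_at_add; first exact: continuous_at_cst.
  exact: continuous_at_opp.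
- apply: (@continuous_at_comp _ _ _ (fun z : X * R => z.1) (fun x => f x v)).
    exact: cvg_fst.
  exact: cf.
- apply: (@continuous_at_comp _ _ _ (fun z : X * R => z.1) (fun x => g x v)).
    exact: cvg_fst.
  exact: cg.
Qed.

End Homotopy.

(** * Radial projection onto the Euclidean sphere *)

Section Sphere.
Context (R : realType) (n : nat).
Local Notation S := (sphere R n).

Definition l2norm (v : 'rV[R]_n.+1) : R := Num.sqrt (\sum_i v 0 i ^+ 2).

Lemma l2norm_eq0 v : (l2norm v == 0) = (v == 0).
Proof.
rewrite /l2norm sqrtr_eq0; apply/idP/eqP => [|->]; last first.
  by rewrite big1 // => i _; rewrite mxE expr0n.
rewrite le_eqVlt ltNge sumr_ge0 ?orbF /= => [|i _]; last exact: sqr_ge0.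
rewrite psumr_eq0 => [/allP v0|i _]; last exact: sqr_ge0.
apply/rowP => i; rewrite mxE; apply/eqP.
by rewrite -sqrf_eq0 -[_ == 0]/(true ==> _) v0 // mem_index_enum.
Qed.

Lemma sphere_scale v : v != 0 -> S ((l2norm v)^-1 *: v).
Proof.
move=> v0; rewrite /sphere /=.
under eq_bigr => i _ do rewrite mxE exprMn.
rewrite -mulr_sumr exprVn sqr_sqrtr; last by apply: sumr_ge0 => i _; exact: sqr_ge0.
rewrite mulVf //; apply: contra_neq v0 => v0.
by apply/eqP; rewrite -l2norm_eq0 /l2norm v0 sqrtr0.
Qed.

(** The value at 0 is a default making the map total; continuity is claimed only away from 0. *)
Definition normalize (v : 'rV[R]_n.+1) : S :=
  match eqVneq v 0 with
  | EqNotNeq _ => sphere_point R n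
  | NeqNotEq v0 => set_elt (sphere_scale v0)
  end.

Lemma normalizeE v : v != 0 -> set_val (normalize v) = (l2norm v)^-1 *: v.
Proof. by rewrite /normalize; case: eqVneq. Qed.

Lemma normalize_id (x : S) : normalize (set_val x) = x.
Proof.
have x1 : l2norm (set_val x) = 1 by rewrite /l2norm (set_valP x) sqrtr1.
have x0 : set_val x != 0 by rewrite -l2norm_eq0 x1 oner_eq0.
by apply: set_type_inj; rewrite normalizeE // x1 invr1 scale1r.
Qed.

Lemma sphere_neq0 (x : S) : set_val x != 0.
Proof. by rewrite -l2norm_eq0 /l2norm (set_valP x) sqrtr1 oner_eq0. Qed.

Lemma normalize_delta c : 0 < c -> normalize (c *: delta_mx 0 0) = sphere_point R n.
Proof.
move=> c0; have nc : l2norm (c *: delta_mx 0 0) = c.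
  rewrite /l2norm (bigD1 0) //= big1 => [|i i0]; last first.
    by rewrite !mxE (negbTE i0) mulr0 expr0n.
  by rewrite !mxE mulr1 addr0 sqrtr_sqr gtr0_norm.
apply: set_type_inj; rewrite normalizeE ?nc; last first.
  by rewrite -l2norm_eq0 nc gt_eqF.
by rewrite scalerA mulVf ?gt_eqF // scale1r.
Qed.

Lemma continuous_at_row_entry (T : topologicalType) (f : T -> 'rV[R]_n.+1) i x :
  continuous_at x f -> continuous_at x (fun y => f y 0 i).
Proof.
move=> cf; apply: (@continuous_at_comp _ _ _ f (fun v : 'rV[R]_n.+1 => v 0 i)) => //.
exact: coord_continuous.
Qed.

Lemma continuous_at_normalize (T : topologicalType) (f : T -> 'rV[R]_n.+1) x :
  f x != 0 -> continuous_at x f -> continuous_at x (fun y => normalize (f y)).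
Proof.
move=> fx0 cf; apply: continuous_at_set_type.
have cl2 : continuous_at x (fun y => l2norm (f y)).
  apply: continuous_at_sqrt; apply: continuous_at_sum => i.
  by apply: continuous_at_mul; exact: continuous_at_row_entry.
have cq : continuous_at x (fun y => (l2norm (f y))^-1 *: f y).
  apply: continuous_at_matrix => i j; rewrite ord1.
  rewrite (_ : (fun _ => _) = fun y => (l2norm (f y))^-1 * f y 0 j); last first.
    by apply/funext => y; rewrite mxE.
  apply: continuous_at_mul; last exact: continuous_at_row_entry.
  by apply: continuous_at_inv => //; rewrite l2norm_eq0.
(* Near [x] the vector stays nonzero, so there [normalize] is the explicit quotient. *)
rewrite /continuous_at normalizeE //; apply: cvg_trans cq.
apply: near_eq_cvg; near=> y; rewrite normalizeE // -l2norm_eq0.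
near: y; apply: (cvgr_neq0 (l2norm (f x))) => //.
by rewrite l2norm_eq0.
Unshelve. all: by end_near. Qed.

(** Serves the joint continuity, in time and point, of homotopies on the wedge. *)
Lemma closed_sphere_point : closed [set sphere_point R n].
Proof.
rewrite (_ : [set _] = set_val @^-1` [set delta_mx 0 0 : 'rV[R]_n.+1]).
  apply: closed_comp; first by move=> x _; exact: initial_continuous.
  by apply: accessible_closed_set1; apply: hausdorff_accessible; exact: norm_hausdorff.
by apply/seteqP; split => [x ->//|x /= xd]; exact: set_type_inj.
Qed.

End Sphere.

(* A coordinate is (is_inner, (k, j)), the pair (k, j) standing for a side of the hexagon;
   (false, j) and (true, j) are opposite sides, and k is the parity of the side. *)
Definition corner : finType := (bool * (bool * 'I_3))%type.

(** * The open cone on the two glued spheres and the homotopy collapsing their intersection *)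

Section Cone.
Context (R : realType).
Implicit Types (y z : corner -> R) (k : bool) (j : 'I_3) (t : R).

Definition outer y k j := y (false, (k, j)).
Definition inner y k j := y (true, (k, j)).
Definition outer_mass y := \sum_p y (false, p).
Definition inner_mass y := \sum_p y (true, p).

(** The cone on $X_k$. The first alternative is the filling simplex on the $a_i, b_i$ of parity k;
    the second is the octahedral sphere joined with the simplex on the other $a_i$. *)
Definition side k y :=
  (forall j, inner y (~~ k) j = 0) /\
  ((forall j, outer y (~~ k) j = 0) \/
   (forall j, outer y k j = 0 \/ inner y k j = 0)).

(* [side k y] as the vanishing of a polynomial in y, to see that it is a closed condition. *)
Definition defect k y : R :=
  \sum_j inner y (~~ k) j +
  (\sum_j outer y (~~ k) j) * (\sum_j outer y k j * inner y k j).

(** For non-negative coordinates every term of the polynomial is non-negative, so it vanishes only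
    termwise. *)
Lemma sideE k y : (forall v, 0 <= y v) -> side k y <-> defect k y = 0.
Proof.
move=> y0.
have s1 : 0 <= \sum_j inner y (~~ k) j by apply: sumr_ge0 => j _; exact: y0.
have s2 : 0 <= \sum_j outer y (~~ k) j by apply: sumr_ge0 => j _; exact: y0.
have s3 : 0 <= \sum_j outer y k j * inner y k j.
  by apply: sumr_ge0 => j _; apply: mulr_ge0; exact: y0.
split=> [[i0 oi']|/eqP def0].
  rewrite /defect big1 // add0r; case: oi' => [om|oi'].
    by rewrite big1 ?mul0r.
  rewrite [X in _ * X]big1 ?mulr0 // => j _.
  by case: (oi' j) => ->; rewrite ?mulr0 ?mul0r.
move: def0; rewrite paddr_eq0 ?mulr_ge0 // mulf_eq0 => /andP[/eqP i0 oi']; split.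
  by move=> j; apply: (psumr_eq0P (fun j _ => y0 (true, (~~ k, j))) i0).
case/orP: oi' => /eqP om; [left|right] => j.
  by apply: (psumr_eq0P (fun j _ => y0 (false, (~~ k, j))) om).
have /eqP := psumr_eq0P (fun j _ => mulr_ge0 (y0 (false, (k, j))) (y0 (true, (k, j)))) om (i := j) isT.
by rewrite mulf_eq0 => /orP[] /eqP; [left|right].
Qed.

(** A side constrains only which coordinates vanish, so it is inherited by smaller supports. *)
Lemma side_support k y z :
  (forall v, y v = 0 -> z v = 0) -> side k y -> side k z.
Proof.
move=> yz [i0 oi']; split=> [j|]; first exact/yz/i0.
case: oi' => oi'; [left|right] => j; first exact/yz/oi'.
by case: (oi' j) => /yz; [left|right].
Qed.

Definition octahedral_cone : set {ptws corner -> R} :=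
  [set y | [/\ forall v, 0 <= y v, exists v, y v != 0 &
               exists k, side k y]].

Lemma outer_mass_ge0 y : (forall v, 0 <= y v) -> 0 <= outer_mass y.
Proof. by move=> y0; apply: sumr_ge0. Qed.

Lemma inner_mass_ge0 y : (forall v, 0 <= y v) -> 0 <= inner_mass y.
Proof. by move=> y0; apply: sumr_ge0. Qed.

Lemma outer_le_mass y p : (forall v, 0 <= y v) -> y (false, p) <= outer_mass y.
Proof. by move=> y0; rewrite /outer_mass (bigD1 p) //= lerDl sumr_ge0. Qed.

Lemma inner_le_mass y p : (forall v, 0 <= y v) -> y (true, p) <= inner_mass y.
Proof. by move=> y0; rewrite /inner_mass (bigD1 p) //= lerDl sumr_ge0. Qed.

Definition pos (x : R) := Num.max x 0.

Lemma pos_ge0 x : 0 <= pos x. Proof. by rewrite /pos le_max lexx orbT. Qed.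
Lemma pos_id x : 0 <= x -> pos x = x. Proof. exact: max_idPl. Qed.
Lemma pos_eq0 x : x <= 0 -> pos x = 0. Proof. exact: max_idPr. Qed.

(* [push t] is a homotopy extension: inner coordinates below t times the outer mass are
   killed, and the time left after the inner part has vanished is spent on moving the outer
   part to its barycentre, so that [push 1] maps the simplex of outer corners to one ray. *)
Definition push t y : {ptws corner -> R} := fun v =>
  if v.1 then pos (y v - t * outer_mass y)
  else (1 - t + t * inner_mass y) * y v + pos (t * outer_mass y - inner_mass y).

Lemma push0 y : (forall v, 0 <= y v) -> push 0 y = y.
Proof.
move=> y0; apply/funext => -[[] p]; rewrite /push /= !mul0r.
  by rewrite subr0 pos_id.
rewrite subr0 addr0 mul1r pos_eq0 ?addr0 //.
by rewrite sub0r oppr_le0 inner_mass_ge0.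
Qed.

Lemma push_ge0 t y v : 0 <= t <= 1 -> (forall v, 0 <= y v) -> 0 <= push t y v.
Proof.
move=> /andP[t0 t1] y0; rewrite /push; case: v.1; first exact: pos_ge0.
rewrite addr_ge0 ?pos_ge0 // mulr_ge0 // addr_ge0 ?subr_ge0 //.
by rewrite mulr_ge0 // inner_mass_ge0.
Qed.

(** Without outer mass the inner coordinates do not move. Otherwise a positive outer coordinate
    stays positive: its factor vanishes only for t = 1 without inner mass, and then the added
    constant is the outer mass. *)
Lemma push_neq0 t y : 0 <= t <= 1 -> (forall v, 0 <= y v) ->
  (exists v, y v != 0) -> exists v, push t y v != 0.
Proof.
move=> /andP[t0 t1] y0 [v yv].
have yv0 : 0 < y v by rewrite lt_def yv y0.
have [om|om] := eqVneq (outer_mass y) 0.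
  exists v; case: v yv yv0 => [[] p] yv yv0; rewrite /push /= om mulr0.
    by rewrite subr0 pos_id.
  by have := outer_le_mass p y0; rewrite om leNgt yv0.
have {}om : 0 < outer_mass y by rewrite lt_def om outer_mass_ge0.
have [p yp] : exists p, 0 < y (false, p).
  have [/eqfunP h|] := boolP [forall p, y (false, p) == 0].
    by move: om; rewrite /outer_mass big1 ?ltxx.
  by rewrite negb_forall => /existsP[p yp]; exists p; rewrite lt_def yp y0.
exists (false, p); rewrite gt_eqF // /push /=.
have i0 := inner_mass_ge0 y0.
have [->|t1'] := eqVneq t 1.
  have [->|i0'] := eqVneq (inner_mass y) 0.
    rewrite !mulr0 mul1r subrr subr0 addr0 mul0r add0r pos_id ?ltW //.
  rewrite subrr add0r !mul1r ltr_wpDr ?pos_ge0 // mulr_gt0 //.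
  by rewrite lt_def i0'.
rewrite ltr_wpDr ?pos_ge0 // mulr_gt0 // ltr_wpDr ?mulr_ge0 //.
by rewrite subr_gt0 lt_def eq_sym t1'.
Qed.

(** While t times the outer mass is at most the inner mass, the added constant is 0 and the support
    can only shrink. Beyond that every inner coordinate has been killed, and points with outer
    support lie on both sides. *)
Lemma push_side t k y : 0 <= t -> (forall v, 0 <= y v) -> side k y -> side k (push t y).
Proof.
move=> t0 y0 yk; have om := outer_mass_ge0 y0.
have [le|lt] := leP (t * outer_mass y) (inner_mass y).
  apply: side_support yk => -[[] p] /= yp; rewrite /push /= yp.
    by rewrite sub0r pos_eq0 // oppr_le0 mulr_ge0.
  by rewrite mulr0 add0r pos_eq0 // subr_le0.
have i0 j k' : inner (push t y) k' j = 0.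
  rewrite /inner /push /= pos_eq0 // subr_le0.
  by apply: le_trans (ltW lt); exact: inner_le_mass.
by split=> [j|]; [exact: i0|right=> j; right; exact: i0].
Qed.

Lemma push_cone t y : 0 <= t <= 1 -> octahedral_cone y -> octahedral_cone (push t y).
Proof.
move=> t01 [y0 yn [k yk]]; split.
- by move=> v; exact: push_ge0.
- exact: push_neq0.
- by exists k; apply: push_side => //; case/andP: t01.
Qed.

End Cone.

(** * Charts between each side and the nonzero vectors of 4-space *)

Section SphereChart.
Context (R : realType).
Implicit Types (y z : corner -> R) (k : bool) (j : 'I_3) (v : 'rV[R]_4).

(** Non-negative over the join with the simplex on the other outer corners, non-positive over the
    filling simplex, zero where the two meet. Dividing by 3 averages over j, which makes [of_row] a
    section of [to_row]. *)
Definition height k y : R :=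
  (\sum_j outer y (~~ k) j - \sum_j Num.min (outer y k j) (inner y k j)) / 3.

(* The boundary of the cross-polytope has coordinates u_j = b_j - a_j and the height tau;
   the shear u_j + tau sends the ray of [outer_center] to the base point e_0. *)
Definition to_row k y : 'rV[R]_4 :=
  \row_i (height k y +
    (if unlift ord0 i is Some j then inner y k j - outer y k j else 0)).

(** Each u_j goes to $b_j$ or $a_j$ according to its sign; a positive height is put on each outer
    corner of the other parity, the absolute value of a negative one on each of the six corners of
    parity k. *)
Definition of_row k v : {ptws corner -> R} := fun c =>
  let tau := v 0 ord0 in let u := v 0 (lift ord0 c.2.2) - tau in
  if c.2.1 == k then pos (if c.1 then u else - u) + pos (- tau)
  else if c.1 then 0 else pos tau.

Lemma to_row0 k y : to_row k y 0 ord0 = height k y.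
Proof. by rewrite mxE unlift_none addr0. Qed.

Lemma to_row_lift k y j :
  to_row k y 0 (lift ord0 j) = height k y + (inner y k j - outer y k j).
Proof. by rewrite mxE liftK. Qed.

Lemma pos_subN (x : R) : pos x - pos (- x) = x.
Proof. by rewrite /pos; case: (leP x 0); case: (leP (- x) 0) => ? ?; lra. Qed.

Lemma min_pos (x : R) : Num.min (pos x) (pos (- x)) = 0.
Proof.
by rewrite /pos; case: (leP x 0); case: (leP (- x) 0) => ? ?; case: leP => ?; lra.
Qed.

Lemma of_row_inner k v j :
  inner (of_row k v) k j = pos (v 0 (lift ord0 j) - v 0 ord0) + pos (- v 0 ord0).
Proof. by rewrite /inner /of_row /= eqxx. Qed.

Lemma of_row_outer k v j :
  outer (of_row k v) k j =
  pos (- (v 0 (lift ord0 j) - v 0 ord0)) + pos (- v 0 ord0).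
Proof. by rewrite /outer /of_row /= eqxx. Qed.

Lemma of_row_innerN k v j : inner (of_row k v) (~~ k) j = 0.
Proof. by rewrite /inner /of_row /=; case: k. Qed.

Lemma of_row_outerN k v j : outer (of_row k v) (~~ k) j = pos (v 0 ord0).
Proof. by rewrite /outer /of_row /=; case: k. Qed.

Lemma to_rowK k v : to_row k (of_row k v) = v.
Proof.
have h : height k (of_row k v) = v 0 ord0.
  rewrite /height.
  under eq_bigr => j _ do rewrite of_row_outerN.
  under [X in _ - X]eq_bigr => j _ do
    rewrite of_row_outer of_row_inner -addr_minl minC min_pos add0r.
  rewrite !sumr_const !card_ord -mulrnBl pos_subN -[_ *+ 3]mulr_natr.
  by rewrite mulfK // pnatr_eq0.
apply/rowP => i; case: (unliftP ord0 i) => [j|] ->.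
  rewrite to_row_lift h of_row_inner of_row_outer.
  rewrite opprD addrACA subrr addr0 pos_subN; lra.
by rewrite to_row0 h.
Qed.

Lemma cornerP k (P : corner -> Prop) :
  (forall j, P (false, (k, j))) -> (forall j, P (true, (k, j))) ->
  (forall j, P (false, (~~ k, j))) -> (forall j, P (true, (~~ k, j))) ->
  forall c, P c.
Proof. by case: k => a b c d [[] [[] j]]. Qed.

Lemma of_row_ge0 k v c : 0 <= of_row k v c.
Proof.
by elim/(@cornerP k): c => j; rewrite /of_row /= ?eqxx ?addr_ge0 ?pos_ge0 //;
  case: eqP => // _; rewrite ?addr_ge0 ?pos_ge0.
Qed.

Lemma to_row_zero k y : (forall c, y c = 0) -> to_row k y = 0.
Proof.
move=> y0; have h : height k y = 0.
  by rewrite /height !big1 ?subrr ?mul0r // => j _; rewrite /inner /outer !y0 ?minxx.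
apply/rowP => i; case: (unliftP ord0 i) => [j|] ->; rewrite [RHS]mxE.
  by rewrite to_row_lift h /inner /outer !y0 subrr addr0.
by rewrite to_row0.
Qed.

Lemma of_row_neq0 k v : v != 0 -> exists c, of_row k v c != 0.
Proof.
move=> v0; have [/eqfunP h|] := boolP [forall c, of_row k v c == 0].
  by move: v0; rewrite -(to_rowK k v) to_row_zero ?eqxx.
by rewrite negb_forall => /existsP.
Qed.

Lemma of_row_side k v : side k (of_row k v).
Proof.
split=> [j|]; first exact: of_row_innerN.
have [v0|v0] := leP (v 0 ord0) 0; [left|right] => j.
  by rewrite of_row_outerN pos_eq0.
rewrite of_row_outer of_row_inner [pos (- v 0 ord0)]pos_eq0 ?oppr_le0 ?ltW // !addr0.
have [u0|/ltW u0] := leP 0 (v 0 (lift ord0 j) - v 0 ord0); [left|right].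
  by rewrite pos_eq0 // oppr_le0.
by rewrite pos_eq0.
Qed.

Lemma of_row_cone k v : v != 0 -> octahedral_cone (of_row k v).
Proof.
move=> v0; split; [exact: of_row_ge0|exact: of_row_neq0|].
by exists k; exact: of_row_side.
Qed.

(** A zero row forces height 0 and equal inner and outer coordinates in parity k, so the outer
    masses of both parities agree. Either alternative of [side] then makes one of them vanish, hence
    both, hence the whole point. *)
Lemma to_row_neq0 k y : octahedral_cone y -> side k y -> to_row k y != 0.
Proof.
move=> [y0 [c yc] _] [i0 oi']; apply/eqP => /rowP r0.
have h : height k y = 0 by rewrite -to_row0 r0 mxE.
have io j : inner y k j = outer y k j.
  by have := r0 (lift ord0 j); rewrite to_row_lift h mxE; lra.
have oN : \sum_j outer y (~~ k) j = \sum_j outer y k j.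
  move: h => /eqP; rewrite /height mulf_eq0 invr_eq0 pnatr_eq0 orbF subr_eq0 => /eqP ->.
  by apply: eq_bigr => j _; rewrite io minxx.
have ok j : outer y k j = 0.
  case: oi' => oi'; last by case: (oi' j) => //; rewrite io.
  have s0 : \sum_j outer y k j = 0 by rewrite -oN big1.
  by apply: (psumr_eq0P _ s0) => // i _; exact: y0.
have oN0 j : outer y (~~ k) j = 0.
  have s0 : \sum_j outer y (~~ k) j = 0 by rewrite oN big1.
  by apply: (psumr_eq0P _ s0) => // i _; exact: y0.
move/negP: yc; apply; apply/eqP.
elim/(@cornerP k): c => j; [exact: ok| |exact: oN0|exact: i0].
by have := io j; rewrite ok.
Qed.

Lemma of_row_scale k v (c : R) d : 0 <= c -> of_row k (c *: v) d = c * of_row k v d.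
Proof.
move=> c0; have pM (x : R) : pos (c * x) = c * pos x.
  by rewrite /pos maxr_pMr // mulr0.
rewrite /of_row /= !mxE -mulrBr -!mulrN.
by case: (d.2.1 == k); case: d.1 => /=; rewrite ?mulr0 // !pM ?mulrDr.
Qed.

(** Prepares a segment from a point to its round trip. The alternative satisfied by y fixes the sign
    of the height, and the coordinates that this alternative makes vanish in y vanish in the round
    trip too. *)
Lemma of_row_to_row_side k y z : (forall c, 0 <= y c) -> side k y ->
  (forall c, y c = 0 -> of_row k (to_row k y) c = 0 -> z c = 0) -> side k z.
Proof.
move=> y0 [i0 oi'] yz; split=> [j|].
  by apply: yz; [exact: i0|exact: of_row_innerN].
case: oi' => oi'.
  left=> j; apply: yz; first exact: oi'.
  apply: (etrans (of_row_outerN _ _ _)); rewrite to_row0 pos_eq0 // /height.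
  rewrite big1 // sub0r mulNr oppr_le0 divr_ge0 // sumr_ge0 // => i _.
  by rewrite le_min /outer /inner !y0.
have h0 : 0 <= height k y.
  rewrite /height [X in _ - X]big1 => [|j _]; last first.
    by case: (oi' j) => ->; [rewrite min_l|rewrite min_r] => //; exact: y0.
  by rewrite subr0 divr_ge0 // sumr_ge0 // => i _; exact: y0.
right=> j; case: (oi' j) => yj; [left|right]; apply: yz => //.
  apply: (etrans (of_row_outer _ _ _)); rewrite to_row_lift to_row0 yj subr0.
  rewrite addrAC subrr add0r !pos_eq0 ?addr0 ?oppr_le0 //; exact: y0.
apply: (etrans (of_row_inner _ _ _)); rewrite to_row_lift to_row0 yj sub0r.
rewrite addrAC subrr add0r !pos_eq0 ?addr0 ?oppr_le0 //; exact: y0.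
Qed.

Definition outer_center (c : R) : corner -> R := fun d => if d.1 then 0 else c.

(** The image does not depend on k: thanks to the shear both charts send this ray to the ray of the
    base point. *)
Lemma to_row_outer_center k c : 0 <= c -> to_row k (outer_center c) = c *: delta_mx 0 0.
Proof.
move=> c0; have h : height k (outer_center c) = c.
  rewrite /height /outer /inner /outer_center /= sumr_const card_ord.
  rewrite [X in _ - X]big1 => [|j _]; last by rewrite min_r.
  by rewrite subr0 -[_ *+ 3]mulr_natr mulfK // pnatr_eq0.
apply/rowP => i; case: (unliftP ord0 i) => [j|] ->; rewrite [RHS]mxE [X in c * X]mxE.
  by rewrite to_row_lift h /inner /outer /= sub0r subrr mulr0.
by rewrite to_row0 h eqxx mulr1.
Qed.

(** Independence of k lets the two inverse charts glue at the wedge point. *)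
Lemma of_row_delta k : of_row k (delta_mx 0 0) = outer_center 1.
Proof.
apply/funext; apply: (@cornerP k) => j.
- apply: (etrans (of_row_outer _ _ _)); rewrite !mxE eqxx /= sub0r opprK.
  by rewrite pos_id ?ler01 // pos_eq0 ?addr0 // oppr_le0 ler01.
- apply: (etrans (of_row_inner _ _ _)); rewrite !mxE eqxx /= sub0r.
  by rewrite pos_eq0 ?addr0 // oppr_le0 ler01.
- apply: (etrans (of_row_outerN _ _ _)); by rewrite mxE eqxx pos_id ?ler01.
- exact: of_row_innerN.
Qed.

(** At time 1 without inner mass the factor of the old coordinates is 0 and only the added constant
    is left. *)
Lemma push1_outer y : (forall j k, inner y k j = 0) -> (forall c, 0 <= y c) ->
  push 1 y = outer_center (outer_mass y).
Proof.
move=> i0 y0; have im : inner_mass y = 0.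
  by rewrite /inner_mass big1 // => -[k j] _; exact: i0.
have om := outer_mass_ge0 y0.
apply/funext => -[[] [k j]]; rewrite /push /outer_center /= !mul1r.
  by rewrite pos_eq0 // -/(inner _ _ _) i0 sub0r oppr_le0.
by rewrite im subrr addr0 mul0r add0r subr0 pos_id.
Qed.

(** The ray over the base point is mapped to itself at all times, which keeps the wedge point fixed
    during the homotopy. *)
Lemma push_outer_center t (c : R) : 0 <= t <= 1 -> 0 <= c ->
  push t (outer_center c) = outer_center ((1 - t) * c + t * outer_mass (outer_center c)).
Proof.
move=> /andP[t0 t1] c0; have y0 : forall d, 0 <= outer_center c d.
  by case=> -[].
have im : inner_mass (outer_center c) = 0.
  by rewrite /inner_mass big1.
have om := outer_mass_ge0 y0.
apply/funext => -[[] [k j]]; rewrite /push /=.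
  by rewrite pos_eq0 // sub0r oppr_le0 mulr_ge0.
by rewrite im mulr0 addr0 subr0 pos_id // mulr_ge0.
Qed.

End SphereChart.

(** * Continuity of the push and of the charts *)

Section ConeContinuity.
Context (R : realType) (T : topologicalType) (x : T).
Implicit Types F : T -> corner -> R.

Lemma continuous_at_push (t : T -> R) F c : continuous_at x t ->
  (forall d, continuous_at x (F^~ d)) ->
  continuous_at x (fun y => push (t y) (F y) c).
Proof.
move=> ct cF; rewrite /push.
have com : continuous_at x (fun y => outer_mass (F y)).
  by apply: continuous_at_sum => p; exact: cF.
have cim : continuous_at x (fun y => inner_mass (F y)).
  by apply: continuous_at_sum => p; exact: cF.
have c0 : continuous_at x (fun=> 0 : R) by exact: continuous_at_cst.
case: c.1.
  apply: continuous_at_max => //; apply: continuous_at_add; first exact: cF.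
  by apply: continuous_at_opp; exact: continuous_at_mul.
apply: continuous_at_add.
  apply: continuous_at_mul; last exact: cF.
  apply: continuous_at_add; last exact: continuous_at_mul.
  apply: continuous_at_add; first exact: continuous_at_cst.
  exact: continuous_at_opp.
apply: continuous_at_max => //; apply: continuous_at_add.
  exact: continuous_at_mul.
exact: continuous_at_opp.
Qed.

Lemma continuous_at_to_row k F : (forall d, continuous_at x (F^~ d)) ->
  continuous_at x (fun y => to_row k (F y)).
Proof.
move=> cF; apply: continuous_at_matrix => i j; rewrite ord1.
rewrite (_ : (fun _ => _) = fun y => height k (F y) +
    (if unlift ord0 j is Some l then inner (F y) k l - outer (F y) k l else 0)).
  apply: continuous_at_add.
    apply: continuous_at_mul; last exact: continuous_at_cst.
    apply: continuous_at_add; first by apply: continuous_at_sum => l; exact: cF.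
    apply: continuous_at_opp; apply: continuous_at_sum => l.
    by apply: continuous_at_min; exact: cF.
  case: (unlift ord0 j) => [l|]; last exact: continuous_at_cst.
  by apply: continuous_at_add; [|apply: continuous_at_opp]; exact: cF.
by apply/funext => y; rewrite mxE.
Qed.

Lemma continuous_at_of_row k (f : T -> 'rV[R]_4) c : continuous_at x f ->
  continuous_at x (fun y => of_row k (f y) c).
Proof.
move=> cf; rewrite /of_row /=.
have c0 : continuous_at x (fun=> 0 : R) by exact: continuous_at_cst.
have ch : continuous_at x (fun y => f y 0 ord0) by exact: continuous_at_row_entry.
have cu : continuous_at x (fun y => f y 0 (lift ord0 c.2.2) - f y 0 ord0).
  apply: continuous_at_add; last exact: continuous_at_opp.
  exact: continuous_at_row_entry.
case: (c.2.1 == k).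
  apply: continuous_at_add; apply: continuous_at_max => //; last exact: continuous_at_opp.
  by case: c.1 => //; exact: continuous_at_opp.
by case: c.1 => //; exact: continuous_at_max.
Qed.

Lemma continuous_at_defect k F : (forall d, continuous_at x (F^~ d)) ->
  continuous_at x (fun y => defect k (F y)).
Proof.
move=> cF; apply: continuous_at_add.
  by apply: continuous_at_sum => j; exact: cF.
apply: continuous_at_mul; apply: continuous_at_sum => j; first exact: cF.
by apply: continuous_at_mul; exact: cF.
Qed.

End ConeContinuity.

(** * Equivalence of the cone with the wedge of two 3-spheres *)

Section ConeWedge.
Context (R : realType).
Local Notation Y := (@octahedral_cone R).
Local Notation S := (sphere R 3).
Local Notation W := (sphere_wedge R 3).

Definition wedge_in (k : bool) : S -> W :=
  @wedge_lift _ (fun _ : bool => set_type S) (fun _ => sphere_point R 3) k.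

Lemma wedge_in_continuous k : continuous (wedge_in k).
Proof.
exact: (@wedge_lift_continuous _ (fun _ : bool => set_type S : topologicalType) (fun _ => sphere_point R 3) k).
Qed.

Lemma wedge_in_point k l :
  wedge_in k (sphere_point R 3) = wedge_in l (sphere_point R 3).
Proof.
exact: (@wedge_liftE _ (fun _ : bool => set_type S) (fun _ => sphere_point R 3)
  l (sphere_point R 3) k (sphere_point R 3)).
Qed.

Lemma wedge_inP (w : W) : exists k x, w = wedge_in k x.
Proof.
have : [set: W] w by [].
rewrite -[X in X w](@wedgeTE _ (fun _ : bool => set_type S) (fun _ => sphere_point R 3)).
by case=> k _ [x _ <-]; exists k, x.
Qed.

(** The cone is not convex, but along a segment only the side condition has to be supplied: a
    nonzero coordinate comes from z at t = 1 and from y before. *)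
Lemma cone_convex (y z : corner -> R) k t : 0 <= t <= 1 ->
  (forall c, 0 <= y c) -> (forall c, 0 <= z c) ->
  (exists c, y c != 0) -> (exists c, z c != 0) ->
  side k (fun c => (1 - t) * y c + t * z c) ->
  Y (fun c => (1 - t) * y c + t * z c).
Proof.
move=> /andP[t0 t1] y0 z0 [c yc] [d zd] s.
have s0 : 0 <= 1 - t by rewrite subr_ge0.
split; last by exists k.
  by move=> e; rewrite addr_ge0 ?mulr_ge0.
have [->|t1'] := eqVneq t 1.
  by exists d; rewrite subrr mul0r add0r mul1r.
exists c; rewrite gt_eqF // ltr_wpDr ?mulr_ge0 // mulr_gt0 //.
  by rewrite subr_gt0 lt_def eq_sym t1'.
by rewrite lt_def yc y0.
Qed.

Lemma side_both k (y : corner -> R) :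
  side k y -> side (~~ k) y -> forall j l, inner y l j = 0.
Proof.
by move=> [i0 _] [i1 _] j l; move: (i0 j) (i1 j); case: k l {i0 i1} => -[].
Qed.

(** A point lying on both sides is sent through the chart of [false]; by [to_wedge_side] the other
    chart gives the same value. *)
Definition to_wedge (y : Y) : W :=
  let k := defect false (set_val y) != 0 in
  wedge_in k (normalize (to_row k (push 1 (set_val y)))).

(** A point on both sides has no inner mass, so [push 1] moves it to the ray of [outer_center], and
    both charts send it to the common base point. *)
Lemma to_wedge_side k (y : Y) : side k (set_val y) ->
  to_wedge y = wedge_in k (normalize (to_row k (push 1 (set_val y)))).
Proof.
have [y0 [c yc] [l yl]] := set_valP y; rewrite /to_wedge.
case: eqVneq => [|d0] /=; last first.
  by case: k => // /(sideE _ y0) /eqP; rewrite (negbTE d0).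
case: k => // /(sideE _ y0) sf st.
have i0 := side_both sf st.
have om : 0 < outer_mass (set_val y).
  rewrite lt_def outer_mass_ge0 // andbT; apply: contra_neq yc => om0.
  case: c => -[] [k j]; first exact: i0.
  by apply/le_anti; rewrite y0 -om0 outer_le_mass.
rewrite push1_outer // !to_row_outer_center ?(ltW om) //.
by rewrite normalize_delta //; exact: wedge_in_point.
Qed.

Lemma push1_to_row_neq0 k (y : Y) : side k (set_val y) ->
  to_row k (push 1 (set_val y)) != 0.
Proof.
move=> yk; have [y0 _ _] := set_valP y; apply: to_row_neq0.
  by apply: push_cone; rewrite ?ler01 ?lexx //; exact: set_valP.
by apply: push_side; rewrite ?ler01.
Qed.

Lemma continuous_at_set_val_eval (V : eqType) (A : set {ptws V -> R}) (x : A) v :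
  continuous_at x (fun y : A => set_val y v).
Proof.
apply: (@continuous_at_comp _ _ _ (fun y : A => set_val y) (fun w : {ptws V -> R} => w v)).
  exact: initial_continuous.
exact: continuous_ptws_eval.
Qed.

Lemma to_wedge_continuous : continuous to_wedge.
Proof.
have cl k : closed [set y : Y | defect k (set_val y) = 0].
  apply: (@closed_comp _ _ (fun y : Y => defect k (set_val y)) [set 0]).
    by move=> y _; apply: continuous_at_defect => d; exact: continuous_at_set_val_eval.
  exact: closed_eq.
pose f k (y : Y) := wedge_in k (normalize (to_row k (push 1 (set_val y)))).
have cf k (y : Y) : defect k (set_val y) = 0 -> continuous_at y (f k).
  have [y0 _ _] := set_valP y; move/(sideE _ y0) => yk.
  apply: (@continuous_at_comp _ _ _ (fun y : Y =>
    normalize (to_row k (push 1 (set_val y)))) (wedge_in k)).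
    apply: continuous_at_normalize; first exact: push1_to_row_neq0.
    apply: continuous_at_to_row => d; apply: continuous_at_push.
      exact: continuous_at_cst.
    by move=> e; exact: continuous_at_set_val_eval.
  exact: wedge_in_continuous.
(* The two sides are closed, being zero sets of the defects, and cover the cone. *)
apply: (@continuous_at_paste _ _ _ _ (f false) (f true)) (cl false) (cl true) _ _ _ _ _.
- move=> y; have [y0 _ [k yk]] := set_valP y.
  by move: yk; rewrite sideE //; case: k; [right|left].
- by move=> y; exact: cf.
- by move=> y; exact: cf.
- move=> y; rewrite inE /= => dy; rewrite (@to_wedge_side false) //.
  by have [y0 _ _] := set_valP y; apply/(sideE false y0).
- move=> y; rewrite inE /= => dy; rewrite (@to_wedge_side true) //.
  by have [y0 _ _] := set_valP y; apply/(sideE true y0).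
Qed.

Definition from_sphere (k : bool) (x : S) : Y :=
  set_elt (of_row_cone k (sphere_neq0 x)).

Lemma val_from_sphere k x : set_val (from_sphere k x) = of_row k (set_val x).
Proof. by []. Qed.

Lemma from_sphere_point k l :
  from_sphere k (sphere_point R 3) = from_sphere l (sphere_point R 3).
Proof.
apply: set_type_inj.
change (of_row k (delta_mx 0 0 : 'rV[R]_4) = of_row l (delta_mx 0 0)).
by rewrite !of_row_delta.
Qed.

Definition from_wedge : W -> Y :=
  @wedge_fun _ (fun _ : bool => set_type S) (fun _ => sphere_point R 3) _ from_sphere.

Lemma from_wedgeE k x : from_wedge (wedge_in k x) = from_sphere k x.
Proof. by apply: wedge_lift_funE; exact: from_sphere_point. Qed.

Lemma from_sphere_continuous k : continuous (from_sphere k).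
Proof.
move=> x; apply: continuous_at_set_type; apply: continuous_at_ptws => c.
by apply: continuous_at_of_row; exact: initial_continuous.
Qed.

Lemma from_wedge_continuous : continuous from_wedge.
Proof.
apply: wedge_fun_continuous; first exact: from_sphere_continuous.
exact: from_sphere_point.
Qed.

(** Two stages: a segment from the round trip to [push 1], then [push] run back from time 1 to time
    0. *)
Lemma from_to_wedge_homotopic : globally_homotopic R (from_wedge \o to_wedge) idfun.
Proof.
have c01 : 0 <= (1 : R) <= 1 by rewrite ler01 lexx.
pose p (y : Y) : Y := set_elt (push_cone c01 (set_valP y)).
apply: (@globally_homotopic_trans _ _ _ _ p).
  pose f (y : Y) := set_val (from_wedge (to_wedge y)).
  pose g (y : Y) := push 1 (set_val y).
  apply: (@globally_homotopic_into_set _ _ _ _ _ _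
    (fun y t => (fun c => (1 - t) * f y c + t * g y c) : {ptws corner -> R})).
  - move=> y t t01; have [y0 yn [k yk]] := set_valP y.
    have py : Y (g y) by exact: set_valP (p y).
    have [gy0 gyn _] := py.
    have [fy0 fyn _] := set_valP (from_wedge (to_wedge y)).
    apply: (@cone_convex _ _ k) => //.
    (* Up to a positive scalar the round trip is [of_row k (to_row k (g y))], so the segment
       vanishes wherever this row image and [g y] do. *)
    apply: (@of_row_to_row_side _ k (g y)) => //.
      by apply: push_side; rewrite ?ler01.
    move=> c gc rc; rewrite gc mulr0 addr0.
    rewrite /f (to_wedge_side yk) from_wedgeE val_from_sphere normalizeE; last exact: push1_to_row_neq0.
    by rewrite of_row_scale ?rc ?mulr0 // invr_ge0 sqrtr_ge0.
  - apply: continuous_line => c y.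
      apply: (@continuous_at_comp _ _ _ (fun y : Y => from_wedge (to_wedge y))
        (fun y : Y => set_val y c)); last exact: continuous_at_set_val_eval.
      apply: continuous_at_comp; first exact: to_wedge_continuous.
      exact: from_wedge_continuous.
    apply: continuous_at_push; first exact: continuous_at_cst.
    by move=> d; exact: continuous_at_set_val_eval.
  - by move=> y; apply/funext => c; rewrite subr0 mul1r mul0r addr0.
  - by move=> y; apply/funext => c; rewrite subrr mul0r mul1r add0r.
apply: (@globally_homotopic_into_set R Y _ (@octahedral_cone R) p idfun
  (fun y t => push (1 - t) (set_val y))).
- move=> y t /andP[t0 t1]; apply: push_cone; last exact: set_valP.
  by rewrite subr_ge0 t1 gerBl.
- move=> z; apply: continuous_at_ptws => c; apply: continuous_at_push.
    apply: continuous_at_add; first exact: continuous_at_cst.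
    by apply: continuous_at_opp; exact: cvg_snd.
  move=> d; apply: (@continuous_at_comp _ _ _ (fun z : Y * R => z.1)
    (fun y : Y => set_val y d)); last exact: continuous_at_set_val_eval.
  exact: cvg_fst.
- by move=> y; rewrite subr0.
- by move=> y; rewrite subrr push0 //; have [] := set_valP y.
Qed.

(** Since [of_row] is a section of [to_row], the round trip differs from the identity only by
    [push 1], which is undone on each sphere by running [push] backwards. *)
Lemma to_from_wedge_homotopic : globally_homotopic R (to_wedge \o from_wedge) idfun.
Proof.
pose K (k : bool) (t : R) (x : S) : W :=
  wedge_in k (normalize (to_row k (push (clip (1 - t)) (of_row k (set_val x))))).
(* The base point stays fixed, so the homotopies of the two spheres glue. *)
have Kpoint t k l : K k t (sphere_point R 3) = K l t (sphere_point R 3).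
  rewrite /K (_ : set_val (sphere_point R 3) = delta_mx 0 0) // !of_row_delta.
  rewrite push_outer_center ?clip_itv ?ler01 //.
  set c := (X in outer_center X).
  (* [c] is a convex combination of 1 and an outer mass that is at least 1. *)
  have c0 : 0 < c.
    have /andP[s0 s1] := clip_itv (1 - t).
    have m1 : 1 <= outer_mass (outer_center (1 : R)).
      by apply: (@outer_le_mass _ _ (false, ord0)) => -[[] ?].
    rewrite /c; nra.
  by rewrite !to_row_outer_center ?(ltW c0) // normalize_delta //; exact: wedge_in_point.
pose H (z : W * R) : W :=
  @wedge_fun _ (fun _ : bool => set_type S) (fun _ => sphere_point R 3) _
    (fun k => K k z.2) z.1.
exists H; split.
- have cH : continuous (uncurry (fun t : R =>
    @wedge_fun _ (fun _ : bool => set_type S) (fun _ => sphere_point R 3) W (K^~ t))).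
    (* Joint continuity descends to the wedge, which has finitely many summands and closed base
       points. *)
    apply: wedge_fun_joint_continuous => //.
    + exact: finite_finset.
    + by move=> ?; exact: closed_sphere_point.
    + move=> k; rewrite (_ : uncurry _ = fun z : R * S => K k z.1 z.2); last first.
        by apply/funext => -[].
      move=> z.
      apply: (@continuous_at_comp _ _ _ (fun z : R * S => normalize (to_row k
        (push (clip (1 - z.1)) (of_row k (set_val z.2))))) (wedge_in k)).
        apply: continuous_at_normalize.
          apply: to_row_neq0.
            apply: push_cone; first exact: clip_itv.
            by apply: of_row_cone; exact: sphere_neq0.
          apply: push_side; first by case/andP: (clip_itv (1 - z.1)).
            by move=> ?; exact: of_row_ge0.
          exact: of_row_side.
        apply: continuous_at_to_row => d; apply: continuous_at_push.
          apply: continuous_at_clip; apply: continuous_at_add; first exact: continuous_at_cst.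
          by apply: continuous_at_opp; exact: cvg_fst.
        move=> e; apply: continuous_at_of_row.
        apply: (@continuous_at_comp _ _ _ (fun z : R * S => z.2)
          (fun x : S => set_val x)); first exact: cvg_snd.
        exact: initial_continuous.
      exact: wedge_in_continuous.
  move=> z; apply: (@continuous_at_comp _ _ _ (fun z : W * R => (z.2, z.1)) _ z _ (cH _)).
  by apply: continuous_at_pair; [exact: cvg_snd|exact: cvg_fst].
- move=> w; have [k [x ->]] := wedge_inP w.
  rewrite /H /= wedge_lift_funE; last by move=> *; exact: Kpoint.
  rewrite from_wedgeE (@to_wedge_side k); last exact: of_row_side.
  by rewrite /K subr0 clip_id ?ler01 ?lexx.
- move=> w; have [k [x ->]] := wedge_inP w.
  rewrite /H /= wedge_lift_funE; last by move=> *; exact: Kpoint.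
  rewrite /K subrr clip_id ?ler01 ?lexx // push0; last by move=> ?; exact: of_row_ge0.
  by rewrite to_rowK normalize_id.
Qed.

Lemma cone_wedge_equivalent :
  globally_homotopy_equivalent R (Y : topologicalType) W.
Proof.
exists to_wedge, from_wedge; split.
- exact: to_wedge_continuous.
- exact: from_wedge_continuous.
- exact: from_to_wedge_homotopic.
- exact: to_from_wedge_homotopic.
Qed.

End ConeWedge.

(** * Numbering of the vertices and edges of the honeycomb graph *)

Local Notation G := honeycomb222.

Definition hex_dir (i : nat) : int * int := nth (0, 0) hex_dirs (i %% 6)%N.

(* With d_i the directions, the vertices are d_i, 2 d_i, 2 d_i + d_(i+1), d_i + 2 d_(i+1). *)
Definition lattice_point (n : nat) : int * int :=
  let d := hex_dir n in let d' := hex_dir n.+1 in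
  nth (0, 0) [:: d; d + d; d + d + d'; d + d' + d'] (n %/ 6)%N.

(* Six edges of each kind, in order: inner, spokes, outer, and the edges just before and
   just after the outer ones along the boundary. *)
Definition edge_ends (n : nat) : nat * nat :=
  let i := (n %% 6)%N in let i' := (n.+1 %% 6)%N in
  nth (0, 0) [:: (i, i'); (i, i + 6); (i + 12, i + 18); (i + 6, i + 12); (i + 18, i' + 6)]%N
    (n %/ 6)%N.

Definition incident (n p : nat) := (p == (edge_ends n).1) || (p == (edge_ends n).2).

Lemma lattice_point_mem n : (n < 24)%N -> lattice_point n \in honeycomb_vertices.
Proof.
move=> n24.
have /allP := (erefl true <: all (fun n => lattice_point n \in honeycomb_vertices) (iota 0 24)).
by apply; rewrite mem_iota.
Qed.

Definition honeycomb_vertex (n : nat) : G :=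
  insubd (SeqSub (@lattice_point_mem 0 isT) : G) (lattice_point n).

Lemma val_honeycomb_vertex n : (n < 24)%N ->
  val (honeycomb_vertex n) = lattice_point n.
Proof. by move=> n24; rewrite val_insubd lattice_point_mem. Qed.

Lemma honeycomb_vertexP (x : G) : exists2 n, (n < 24)%N & x = honeycomb_vertex n.
Proof.
have /allP h := (erefl true <: all (fun u => u \in map lattice_point (iota 0 24)) honeycomb_vertices).
have /mapP[n] := h _ (valP x); rewrite mem_iota => n24 xn.
by exists n => //; apply: val_inj; rewrite val_honeycomb_vertex.
Qed.

Lemma honeycomb_vertex_inj m n : (m < 24)%N -> (n < 24)%N ->
  honeycomb_vertex m = honeycomb_vertex n -> m = n.
Proof.
move=> m24 n24 /(congr1 val); rewrite !val_honeycomb_vertex // => mn.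
have u : uniq (map lattice_point (iota 0 24)) by vm_compute.
have nthE k : (k < 24)%N -> nth (0, 0) (map lattice_point (iota 0 24)) k = lattice_point k.
  by move=> k24; rewrite (nth_map 0%N) ?size_iota // nth_iota.
by apply/eqP; rewrite -(nth_uniq (0, 0) _ _ u) ?size_map ?size_iota // !nthE // mn.
Qed.

Definition lattice_adj (u v : int * int) :=
  (v - u \in hex_dirs) &&
  has (fun c => (u \in hex_cell c) && (v \in hex_cell c)) honeycomb_centres.

Lemma adj_honeycomb_vertex m n : (m < 24)%N -> (n < 24)%N ->
  adj (honeycomb_vertex m) (honeycomb_vertex n) =
  lattice_adj (lattice_point m) (lattice_point n).
Proof. by move=> m24 n24; rewrite -!val_honeycomb_vertex. Qed.

Lemma edge_ends_lt n : (n < 30)%N -> ((edge_ends n).1 < 24)%N /\ ((edge_ends n).2 < 24)%N.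
Proof.
move=> n30; apply/andP.
have /allP := (erefl true <: all (fun n => ((edge_ends n).1 < 24)%N && ((edge_ends n).2 < 24)%N) (iota 0 30)).
by apply; rewrite mem_iota.
Qed.

Definition edge_set (n : nat) : {set G} :=
  [set honeycomb_vertex (edge_ends n).1; honeycomb_vertex (edge_ends n).2]%SET.

Lemma edge_set_mem n : (n < 30)%N -> edge_set n \in edges G.
Proof.
move=> n30; have [e1 e2] := edge_ends_lt n30.
rewrite finset.inE; apply/existsP; exists (honeycomb_vertex (edge_ends n).1).
apply/existsP; exists (honeycomb_vertex (edge_ends n).2).
rewrite eqxx andbT adj_honeycomb_vertex //.
have /allP := (erefl true <: all (fun n => lattice_adj (lattice_point (edge_ends n).1) (lattice_point (edge_ends n).2)) (iota 0 30)).
by apply; rewrite mem_iota.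
Qed.

Definition honeycomb_edge (n : nat) : edge G :=
  insubd (exist (fun e => e \in edges G) _ (@edge_set_mem 0 isT) : edge G) (edge_set n).

Lemma val_honeycomb_edge n : (n < 30)%N -> val (honeycomb_edge n) = edge_set n.
Proof. by move=> n30; rewrite val_insubd edge_set_mem. Qed.

(** A finite check over pairs of vertex numbers finds every adjacent pair, in one of its two orders,
    among the listed ends. *)
Lemma honeycomb_edgeP (e : edge G) : exists2 n, (n < 30)%N & e = honeycomb_edge n.
Proof.
have := valP e; rewrite finset.inE => /existsP[x /existsP[y /andP[]]].
have [m m24 ->] := honeycomb_vertexP x; have [n n24 ->] := honeycomb_vertexP y.
rewrite adj_honeycomb_vertex // => mn /eqP eE.
have /allP/(_ m) := (erefl true <: all (fun m => all (fun n =>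
  lattice_adj (lattice_point m) (lattice_point n) ==>
  has (fun l => (edge_ends l == (m, n)) || (edge_ends l == (n, m))) (iota 0 30))
  (iota 0 24)) (iota 0 24)).
rewrite mem_iota => /(_ m24)/allP/(_ n); rewrite mem_iota mn => /(_ n24)/hasP[l].
rewrite mem_iota => l30 lE; exists l => //; apply: val_inj.
rewrite val_honeycomb_edge // eE /edge_set.
by case/orP: lE => /eqP -> //=; rewrite finset.setUC.
Qed.

Lemma honeycomb_edge_incident n p : (n < 30)%N -> (p < 24)%N ->
  (honeycomb_vertex p \in val (honeycomb_edge n)) = incident n p.
Proof.
move=> n30 p24; have [e1 e2] := edge_ends_lt n30.
rewrite val_honeycomb_edge // !finset.inE /incident.
have vE q : (q < 24)%N -> (honeycomb_vertex p == honeycomb_vertex q) = (p == q).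
  by move=> q24; apply/eqP/eqP => [/honeycomb_vertex_inj->|->].
by rewrite !vE.
Qed.

(** By a finite check an edge number is determined by its incident vertices, and incidence is read
    off the graph. *)
Lemma honeycomb_edge_inj m n : (m < 30)%N -> (n < 30)%N ->
  honeycomb_edge m = honeycomb_edge n -> m = n.
Proof.
move=> m30 n30 mn.
have /allP/(_ m) := (erefl true <: all (fun m => all (fun n =>
  all (fun p => incident m p == incident n p) (iota 0 24) ==> (m == n))
  (iota 0 30)) (iota 0 30)).
rewrite mem_iota => /(_ m30)/allP/(_ n); rewrite mem_iota => /(_ n30)/implyP h.
apply/eqP/h; apply/allP => p; rewrite mem_iota => p24.
by rewrite -!honeycomb_edge_incident // mn.
Qed.

(** * Enumeration of the perfect matchings *)

Definition incident_edges (p : nat) := [seq n <- iota 0 30 | incident n p].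

(** An edge meets itself, so within a matching meeting means equality. *)
Definition meet (m n : nat) := incident m (edge_ends n).1 || incident m (edge_ends n).2.

Lemma meetP m n : (n < 30)%N ->
  meet m n <-> exists p, [/\ (p < 24)%N, incident m p & incident n p].
Proof.
move=> n30; have [e1 e2] := edge_ends_lt n30.
split=> [/orP[] mp|[p [_ mp /orP[]/eqP pn]]]; last 2 first.
- by rewrite /meet -pn mp.
- by rewrite /meet -pn mp orbT.
- by exists (edge_ends n).1; rewrite e1 mp /incident eqxx.
- by exists (edge_ends n).2; rewrite e2 mp /incident eqxx orbT.
Qed.

(** One step of a branching search over the vertices: an uncovered vertex is matched by each of its
    edges that is disjoint from the edges chosen so far. *)
Definition extend_matching (p : nat) (s : seq nat) : seq (seq nat) :=
  if has (fun n => incident n p) s then [:: s]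
  else [seq n :: s | n <- incident_edges p & ~~ has (meet n) s].

Definition extend_matchings (ss : seq (seq nat)) (p : nat) : seq (seq nat) :=
  flatten [seq extend_matching p s | s <- ss].

(* Sealed by an opaque proof, as [done] would otherwise try to enumerate the list. *)
Fact matchings_subproof :
  {ss : seq (seq nat) | ss = foldl extend_matchings [:: [::]] (iota 0 24)}.
Proof. exact (exist _ _ erefl). Qed.

Definition matchings : seq (seq nat) := sval matchings_subproof.

Lemma matchingsE : matchings = foldl extend_matchings [:: [::]] (iota 0 24).
Proof. exact (svalP matchings_subproof). Qed.

(** Used to show that a perfect matching containing a listed one is equal to it. *)
Lemma matchings_maximal :
  all (fun s => all (fun n => has (meet n) s) (iota 0 30)) matchings.
Proof. by rewrite matchingsE; vm_compute. Qed.

Lemma matchings_disjoint :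
  all (fun s => all (fun m => all (fun n => meet m n ==> (m == n)) s) s) matchings.
Proof. by rewrite matchingsE; vm_compute. Qed.

Lemma matchings_cover : all (fun s => all (fun p =>
  has (fun n => (n < 30)%N && incident n p) s) (iota 0 24)) matchings.
Proof. by rewrite matchingsE; vm_compute. Qed.

Lemma perfect_matching_cover (M : {set edge G}) p : perfect_matching M -> (p < 24)%N ->
  exists n, [/\ (n < 30)%N, honeycomb_edge n \in M & incident n p].
Proof.
move=> /andP[_ /forallP/(_ (honeycomb_vertex p))/existsP[e /andP[eM pe]]] p24.
have [n n30 en] := honeycomb_edgeP e; exists n.
by split; rewrite // -?honeycomb_edge_incident // -en.
Qed.

Lemma perfect_matching_meet (M : {set edge G}) m n : perfect_matching M ->
  (m < 30)%N -> (n < 30)%N -> honeycomb_edge m \in M -> honeycomb_edge n \in M ->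
  meet m n -> m = n.
Proof.
move=> /andP[/forallP h _] m30 n30 mM nM /(meetP _ n30)[p [p24 mp np]].
apply: honeycomb_edge_inj => //; apply/eqP; apply/negPn/negP => mn.
have /implyP/(_ mM)/forallP/(_ (honeycomb_edge n))/implyP/(_ nM)/implyP/(_ mn) := h (honeycomb_edge m).
move=> /pred0P/(_ (honeycomb_vertex p)) /=.
by rewrite !honeycomb_edge_incident // mp np.
Qed.

(** At every vertex some branch of the search follows the edge of M, so a listed matching is
    contained in M; every edge of M meets one of its edges and therefore equals it. *)
Lemma perfect_matching_listed (M : {set edge G}) : perfect_matching M ->
  exists2 s, s \in matchings &
    forall n, (n < 30)%N -> (honeycomb_edge n \in M) = (n \in s).
Proof.
move=> pM; pose good (s : seq nat) := forall n, n \in s -> (n < 30)%N /\ honeycomb_edge n \in M.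
have step p s : (p < 24)%N -> good s -> exists2 s', s' \in extend_matching p s & good s'.
  move=> p24 gs; rewrite /extend_matching; case: hasP => [_|ns].
    by exists s => //; rewrite mem_head.
  have [n [n30 nM np]] := perfect_matching_cover pM p24.
  exists (n :: s); last by move=> m; rewrite in_cons => /predU1P[->|/gs].
  apply/mapP; exists n => //; rewrite mem_filter /incident_edges mem_filter np.
  rewrite mem_iota n30 !andbT; apply/hasPn => m ms; apply/negP => mn.
  have [m30 mM] := gs m ms; apply: ns; exists m => //.
  by rewrite -(perfect_matching_meet pM n30 m30 nM mM mn).
have [s sm gs] : exists2 s, s \in matchings & good s.
  rewrite matchingsE.
  have : all (fun p => p < 24)%N (iota 0 24) by [].
  have : exists2 s, s \in [:: [::]] & good s by exists [::].
  elim: (iota 0 24) [:: [::]] => [//|p ps IH] ss /= [s sss gs] /andP[p24 ps24].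
  apply: IH => //; have [s' s's gs'] := step p s p24 gs.
  by exists s' => //; apply/flattenP; exists (extend_matching p s) => //; exact: map_f.
exists s => // n n30; apply/idP/idP => [nM|/gs[]//].
have /allP/(_ s sm)/allP/(_ n) := matchings_maximal.
rewrite mem_iota => /(_ n30)/hasP[m ms nm]; have [m30 mM] := gs m ms.
by rewrite (perfect_matching_meet pM n30 m30 nM mM nm).
Qed.

Lemma listed_perfect_matching s : s \in matchings ->
  exists2 M : {set edge G}, perfect_matching M &
    forall n, (n < 30)%N -> (honeycomb_edge n \in M) = (n \in s).
Proof.
move=> sm; exists [set e : edge G | [exists n : 'I_30, (val n \in s) && (e == honeycomb_edge n)]]%SET.
  apply/andP; split.
    apply/forallP => e; apply/implyP; rewrite finset.inE => /existsP[m /andP[ms /eqP ->]].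
    apply/forallP => f; apply/implyP; rewrite finset.inE => /existsP[n /andP[ns /eqP ->]].
    apply/implyP => mn; apply/pred0P => x /=; have [p p24 ->] := honeycomb_vertexP x.
    rewrite !honeycomb_edge_incident //; apply/negbTE/negP => mnp.
    have /allP/(_ s sm)/allP/(_ (val m) ms)/allP/(_ (val n) ns)/implyP := matchings_disjoint.
    have mnmeet : meet m n by apply/meetP => //; exists p; case/andP: mnp.
    by move=> /(_ mnmeet)/eqP mnE; rewrite /= mnE eqxx in mn.
  apply/forallP => x; have [p p24 ->] := honeycomb_vertexP x.
  have /allP/(_ s sm)/allP/(_ p) := matchings_cover.
  rewrite mem_iota => /(_ p24)/hasP[n ns /andP[n30 np]].
  apply/existsP; exists (honeycomb_edge n); rewrite honeycomb_edge_incident // np andbT.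
  by rewrite finset.inE; apply/existsP; exists (Ordinal n30); rewrite /= ns eqxx.
move=> n n30; rewrite finset.inE; apply/existsP/idP => [[m /andP[ms /eqP mn]]|ns].
  by rewrite (honeycomb_edge_inj n30 (ltn_ord m) mn).
by exists (Ordinal n30); rewrite /= ns eqxx.
Qed.

(** * Domination by the twelve corner edges, and the shapes of the matchings restricted to them *)

(* Sends (k, j) to a side of the hexagon of parity k, opposite sides sharing j. *)
Definition position (k : bool) (j : nat) : nat :=
  if k then ((j.*2 + 3) %% 6)%N else j.*2.

Definition position_inv (i : nat) : bool * nat :=
  if odd i then (true, ((i + 3)./2 %% 3)%N) else (false, i./2).

Definition corner_index (o : bool) (k : bool) (j : nat) : nat :=
  ((if o then 0 else 12) + position k j)%N.

(* Outer edge contained in every perfect matching that contains the edge n (n itself if n is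
   inner). *)
Definition target (n : nat) : bool * (bool * nat) :=
  let i := (n %% 6)%N in
  ((n < 6)%N, position_inv (nth i [:: i; i; i; ((i + 5) %% 6)%N; (i.+1 %% 6)%N] (n %/ 6)%N)).

Lemma corner_index_lt o k (j : 'I_3) : (corner_index o k j < 30)%N.
Proof. by case: o k j => -[] [[|[|[|]]]]. Qed.

Lemma target_lt n : (n < 30)%N -> ((target n).2.2 < 3)%N.
Proof.
move=> n30; have /allP/(_ n) := (erefl true <: all (fun n => ((target n).2.2 < 3)%N) (iota 0 30)).
by rewrite mem_iota; apply.
Qed.

Lemma target_corner_index o k (j : 'I_3) :
  target (corner_index o k j) = (o, (k, nat_of_ord j)).
Proof. by case: o k j => -[] [[|[|[|]]]]. Qed.

(** This is the domination: replacing an edge by its target never leaves a perfect matching. *)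
Lemma matchings_target : all (fun s => all (fun n =>
  let c := target n in corner_index c.1 c.2.1 c.2.2 \in s) s) matchings.
Proof. by rewrite matchingsE; vm_compute. Qed.

(** The first alternative covers the free faces: four outer edges and, of the inner ones, at most
    the opposite pair of index j. The second says that the restriction lies in $X_k$. *)
Definition matching_shape (P : bool -> bool -> nat -> bool) :=
  has (fun j => [&& ~~ P false false j, ~~ P false true j &
    all (fun i => (i != j) ==> [&& P false false i, P false true i,
      ~~ P true false i & ~~ P true true i]) (iota 0 3)]) (iota 0 3) ||
  has (fun k => all (fun j => ~~ P true (~~ k) j) (iota 0 3) &&
    (all (fun j => ~~ P false (~~ k) j) (iota 0 3) ||
     all (fun j => ~~ (P false k j && P true k j)) (iota 0 3))) [:: false; true].

Lemma matchings_shape : all (fun s =>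
  matching_shape (fun o k j => corner_index o k j \in s)) matchings.
Proof. by rewrite matchingsE; vm_compute. Qed.

(** For each parity, the simplex that fills the octahedral sphere is a face. *)
Definition has_full (ss : seq (seq nat)) := all (fun k => has (fun s =>
  all (fun j => (corner_index false k j \in s) && (corner_index true k j \in s))
    (iota 0 3)) ss) [:: false; true].

Lemma matchings_full : has_full matchings.
Proof. by rewrite matchingsE; vm_compute. Qed.

(** The eight triangles of each octahedral sphere, given by three binary choices, joined with the
    simplex on the other outer edges. *)
Definition has_octants (ss : seq (seq nat)) := let B := [:: false; true] in
  all (fun k => all (fun b0 => all (fun b1 => all (fun b2 =>
    has (fun s => all (fun j => (corner_index false (~~ k) j \in s) &&
      (corner_index (nth false [:: b0; b1; b2] j) k j \in s)) (iota 0 3)) ss)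
  B) B) B) B.

Lemma matchings_octant : has_octants matchings.
Proof. by rewrite matchingsE; vm_compute. Qed.

Definition corner_edge (c : corner) : edge G :=
  honeycomb_edge (corner_index c.1 c.2.1 c.2.2).

Definition edge_index (e : edge G) : nat :=
  find (fun n => honeycomb_edge n == e) (iota 0 30).

Lemma edge_indexK n : (n < 30)%N -> edge_index (honeycomb_edge n) = n.
Proof.
move=> n30; rewrite /edge_index.
have h : has (fun m => honeycomb_edge m == honeycomb_edge n) (iota 0 30).
  by apply/hasP; exists n; rewrite ?mem_iota.
have := nth_find 0%N h; rewrite has_find size_iota in h.
by rewrite nth_iota // => /eqP; apply: honeycomb_edge_inj.
Qed.

Definition edge_corner (e : edge G) : corner :=
  let c := target (edge_index e) in (c.1, (c.2.1, inord c.2.2)).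

Lemma corner_edgeK : cancel corner_edge edge_corner.
Proof.
move=> [b [k j]]; rewrite /edge_corner edge_indexK ?corner_index_lt //.
by rewrite target_corner_index /= inord_val.
Qed.

Lemma corner_edge_retract (M : {set edge G}) e : perfect_matching M ->
  e \in M -> corner_edge (edge_corner e) \in M.
Proof.
move=> pM eM; have [s sm sE] := perfect_matching_listed pM.
have [n n30 en] := honeycomb_edgeP e; move: eM; rewrite en sE // => ns.
rewrite /corner_edge /edge_corner edge_indexK //= inordK ?target_lt //.
have /allP/(_ _ sm)/allP/(_ _ ns) /= tn := matchings_target.
rewrite sE // -(inordK (target_lt n30)); exact: corner_index_lt.
Qed.

Lemma perfect_matching_shape (M : {set edge G}) : perfect_matching M ->
  let P o k j := corner_edge (o, (k, j)) \in M in
  (exists j, forall k, ~~ P false k j /\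
     forall i, i != j -> P false k i /\ ~~ P true k i) \/
  (exists k, (forall j, ~~ P true (~~ k) j) /\
    ((forall j, ~~ P false (~~ k) j) \/ (forall j, ~~ (P false k j && P true k j)))).
Proof.
move=> pM P; have [s sm sE] := perfect_matching_listed pM.
have PE o k (j : 'I_3) : P o k j = (corner_index o k j \in s).
  by rewrite /P /corner_edge /= sE // corner_index_lt.
have in3 (j : 'I_3) : val j \in iota 0 3 by rewrite mem_iota ltn_ord.
have /allP/(_ _ sm)/orP[/hasP[j]|/hasP[k _ /andP[/allP i0]]] := matchings_shape.
  rewrite mem_iota => j3 /and3P[p0 p1 /allP pi]; left; exists (Ordinal j3) => k.
  split=> [|i ij]; first by rewrite PE; case: k.
  have /implyP/(_ ij)/and4P[a b c d] := pi _ (in3 i).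
  by rewrite !PE; case: k.
move=> h; right; exists k; split=> [j|]; first by rewrite PE; exact: (i0 _ (in3 j)).
case/orP: h => /allP h; [left|right] => j; rewrite !PE; exact: (h _ (in3 j)).
Qed.

Lemma perfect_matching_octant k (t : 'I_3 -> bool) :
  exists2 M : {set edge G}, perfect_matching M &
    forall j, corner_edge (false, (~~ k, j)) \in M /\ corner_edge (t j, (k, j)) \in M.
Proof.
have inB (b : bool) : b \in [:: false; true] by case: b.
have /allP/(_ _ (inB k))/allP/(_ _ (inB (t ord0)))/allP/(_ _ (inB (t (inord 1))))
  /allP/(_ _ (inB (t (inord 2))))/hasP[s sm /allP h] := matchings_octant.
have [M pM ME] := listed_perfect_matching sm; exists M => // j.
rewrite /corner_edge !ME ?corner_index_lt //=; apply/andP.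
have -> : t j = nth false [:: t ord0; t (inord 1); t (inord 2)] j.
  by case: j => [[|[|[|j]]] j3] //=; congr t; apply: val_inj; rewrite /= ?inordK.
by apply: h; rewrite mem_iota ltn_ord.
Qed.

Lemma perfect_matching_full k :
  exists2 M : {set edge G}, perfect_matching M &
    forall j, corner_edge (false, (k, j)) \in M /\ corner_edge (true, (k, j)) \in M.
Proof.
have inB (b : bool) : b \in [:: false; true] by case: b.
have /allP/(_ _ (inB k))/hasP[s sm /allP h] := matchings_full.
have [M pM ME] := listed_perfect_matching sm; exists M => // j.
rewrite /corner_edge !ME ?corner_index_lt //=; apply/andP.
by apply: h; rewrite mem_iota ltn_ord.
Qed.

(** * Equivalence of the realization with the cone *)

Section ComplexCone.
Context (R : realType).
Local Notation X := (realization R (perfect_matching_complex honeycomb222)).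
Local Notation Y := (@octahedral_cone R).
Implicit Types (x : edge G -> R) (y : corner -> R).

Lemma realizationP x : barycentric (perfect_matching_complex honeycomb222) x <->
  [/\ forall e, 0 <= x e, \sum_e x e = 1 &
    exists2 M : {set edge G}, perfect_matching M & forall e, x e != 0 -> e \in M].
Proof.
split=> -[x0 x1].
  rewrite /= finset.inE => /existsP[M /andP[pM /fintype.subsetP xM]].
  by split=> //; exists M => // e xe; apply: xM; rewrite finset.inE.
move=> [M pM xM]; split=> //=; rewrite finset.inE; apply/existsP; exists M.
by rewrite pM; apply/fintype.subsetP => e; rewrite finset.inE; exact: xM.
Qed.

(** The linear extension of the retraction of edges onto corners. *)
Definition collect x : corner -> R := fun c => \sum_(e | edge_corner e == c) x e.

(** The largest amount that can be subtracted from both opposite inner corners of index j;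
    [separate] adds it to each of the four outer corners of the other indices. *)
Definition common y j := Num.min (inner y false j) (inner y true j).

(* Collapses the free faces spanned by two opposite inner corners. *)
Definition separate y : {ptws corner -> R} := fun c =>
  if c.1 then y c - common y c.2.2
  else y c + \sum_(i | i != c.2.2) common y i.

(** Extension by zero along the injection [corner_edge], rescaled to total mass 1. *)
Definition distribute y : {ptws edge G -> R} := fun e =>
  (\sum_(c | corner_edge c == e) y c) / \sum_c y c.

Lemma common_ge0 y j : (forall c, 0 <= y c) -> 0 <= common y j.
Proof. by move=> y0; rewrite le_min !y0. Qed.

Lemma common_neq0 y j k : (forall c, 0 <= y c) -> common y j != 0 -> inner y k j != 0.
Proof.
move=> y0; apply: contra_neq => i0; apply/le_anti.
by rewrite common_ge0 // andbT -i0 ge_min; case: k {i0}; rewrite lexx ?orbT.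
Qed.

Lemma separate_ge0 y c : (forall c, 0 <= y c) -> 0 <= separate y c.
Proof.
move=> y0; case: c => -[] [k j]; rewrite /separate /=.
  by rewrite subr_ge0 ge_min; case: k; rewrite lexx ?orbT.
by rewrite addr_ge0 // sumr_ge0 // => i _; exact: common_ge0.
Qed.

Lemma separate_id y : (forall j, common y j = 0) -> separate y = y.
Proof.
move=> c0; apply/funext => -[[] [k j]]; rewrite /separate /= ?c0 ?subr0 //.
by rewrite big1 ?addr0.
Qed.

Lemma separate_neq0 y : (forall c, 0 <= y c) -> (exists c, y c != 0) ->
  exists c, separate y c != 0.
Proof.
move=> y0 yn; have [/forallP c0|] := boolP [forall j, common y j == 0].
  by rewrite separate_id // => j; exact/eqP.
rewrite negb_forall => /existsP[j cj].
(* [lift j ord0] is an index other than j, so its outer corners receive [common y j]. *)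
exists (false, (false, lift j ord0)); rewrite gt_eqF // /separate /=.
rewrite ltr_wpDl // (bigD1 j) ?neq_lift //= ltr_wpDr //.
  by rewrite sumr_ge0 // => i _; exact: common_ge0.
by rewrite lt_def cj common_ge0.
Qed.

Lemma collect_ge0 x c : (forall e, 0 <= x e) -> 0 <= collect x c.
Proof. by move=> x0; rewrite sumr_ge0. Qed.

Lemma collect_support x (M : {set edge G}) c : perfect_matching M ->
  (forall e, x e != 0 -> e \in M) -> collect x c != 0 -> corner_edge c \in M.
Proof.
move=> pM xM; apply: contra_neqT => cM; rewrite /collect big1 // => e /eqP ec.
apply/eqP; apply: contraNT cM => /xM eM.
by rewrite -ec; exact: corner_edge_retract.
Qed.

Lemma collect_neq0 x : (forall e, 0 <= x e) -> \sum_e x e = 1 ->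
  exists c, collect x c != 0.
Proof.
move=> x0 x1; have [/forallP c0|] := boolP [forall c, collect x c == 0]; last first.
  by rewrite negb_forall => /existsP.
move: (oner_neq0 R); rewrite -x1 (partition_big edge_corner xpredT) //= big1 ?eqxx //.
by move=> c _; exact/eqP/c0.
Qed.

(** An outer corner of index j gains mass only if some opposite inner pair of index i other than j
    lies in M. By the shape of M, all outer edges of indices other than i then lie in M. *)
Lemma separate_collect_support x (M : {set edge G}) c : perfect_matching M ->
  (forall e, 0 <= x e) -> (forall e, x e != 0 -> e \in M) ->
  separate (collect x) c != 0 -> corner_edge c \in M.
Proof.
move=> pM x0 xM; have c0 d := collect_ge0 d x0.
have cM d := collect_support pM xM (c := d).
case: c => -[] [k j]; rewrite /separate /=.
  have [->|/cM//] := eqVneq (collect x (true, (k, j))) 0.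
  by rewrite sub0r oppr_eq0 => /(common_neq0 k c0)/cM.
have [->|/cM//] := eqVneq (collect x (false, (k, j))) 0.
rewrite add0r => sn; have [i ij ci] : exists2 i, i != j & common (collect x) i != 0.
  have [/forallP h|] := boolP [forall i, (i != j) ==> (common (collect x) i == 0)].
    by move: sn; rewrite big1 ?eqxx // => i ij; apply/eqP; exact: (implyP (h i)).
  by rewrite negb_forall => /existsP[i]; rewrite negb_imply => /andP[]; exists i.
have bM l : corner_edge (true, (l, i)) \in M by apply: cM; exact: common_neq0 ci.
case: (perfect_matching_shape pM) => [[j0 h]|[l [h _]]]; last by move: (h i); rewrite bM.
have [ij0|ij0] := eqVneq i j0.
  by have [_ /(_ j)] := h k; rewrite -ij0 eq_sym => /(_ ij)[].
by have [_ /(_ i ij0)[_]] := h k; rewrite bM.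
Qed.

Lemma separate_collect_side x (M : {set edge G}) : perfect_matching M ->
  (forall e, 0 <= x e) -> (forall e, x e != 0 -> e \in M) ->
  exists k, side k (separate (collect x)).
Proof.
move=> pM x0 xM; have c0 d := collect_ge0 d x0.
have sM c : corner_edge c \notin M -> separate (collect x) c = 0.
  by move=> cM; apply/eqP; apply: contraNT cM; exact: separate_collect_support.
case: (perfect_matching_shape pM) => [[j h]|[k [i0 h]]]; last first.
  exists k; split=> [j|]; first by apply: sM.
  case: h => h; [left|right] => j; first by apply: sM.
  by have := h j; rewrite negb_and => /orP[] /sM; [left|right].
(* Of the two opposite inner corners of index j, [separate] kills the smaller one; k is the parity
   of the other, with ties going to [false]. *)
pose k := inner (collect x) false j < inner (collect x) true j.
have mk : inner (separate (collect x)) (~~ k) j = 0.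
  rewrite /inner /separate /common /= /k.
  case: ltP => ? /=; first by rewrite subrr.
  by rewrite subrr.
exists k; split=> [i|].
  have [->//|ij] := eqVneq i j; apply: sM.
  by have [_ /(_ i ij)[]] := h (~~ k).
right=> i; have [->|ij] := eqVneq i j; [left|right]; apply: sM; have [h1 h2] := h k => //.
by have [] := h2 i ij.
Qed.

Lemma separate_collect_cone (x : X) : Y (separate (collect (set_val x))).
Proof.
have /realizationP[x0 x1 [M pM xM]] := set_valP x.
split; last exact: separate_collect_side xM.
- by move=> c; apply: separate_ge0 => d; exact: collect_ge0.
- apply: separate_neq0; first by move=> d; exact: collect_ge0.
  exact: collect_neq0.
Qed.

Lemma total_gt0 y : (forall c, 0 <= y c) -> (exists c, y c != 0) -> 0 < \sum_c y c.
Proof.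
move=> y0 [c yc]; rewrite (bigD1 c) //= ltr_wpDr ?sumr_ge0 //.
by rewrite lt_def yc y0.
Qed.

Lemma distribute_ge0 y e : (forall c, 0 <= y c) -> 0 <= distribute y e.
Proof. by move=> y0; rewrite divr_ge0 ?sumr_ge0. Qed.

Lemma distribute_sum y : 0 < \sum_c y c -> \sum_e distribute y e = 1.
Proof.
move=> y0; rewrite -mulr_suml; have := partition_big corner_edge xpredT
  (F := y) (P := xpredT) (fun _ _ => isT) => /= <-.
by rewrite divff // gt_eqF.
Qed.

Lemma distribute_support y (M : {set edge G}) :
  (forall c, y c != 0 -> corner_edge c \in M) ->
  forall e, distribute y e != 0 -> e \in M.
Proof.
move=> yM e; apply: contra_neqT => eM; rewrite /distribute big1 ?mul0r // => c /eqP ce.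
by apply/eqP; apply: contraNT eM => /yM; rewrite ce.
Qed.

(** The first alternative of [side] is covered by the filling simplex, the second by an octant. *)
Lemma cone_matching y : Y y -> exists2 M : {set edge G}, perfect_matching M &
  forall c, y c != 0 -> corner_edge c \in M.
Proof.
move=> [y0 _ [k [i0 h]]].
case: h => h.
  have [M pM MP] := perfect_matching_full k; exists M => // c yc.
  move: yc; elim/(@cornerP k): c => j yj.
  - by have [] := MP j.
  - by have [] := MP j.
  - by move: yj; rewrite -[y _]/(outer y (~~ k) j) h eqxx.
  - by move: yj; rewrite -[y _]/(inner y (~~ k) j) i0 eqxx.
(* The octant is chosen by taking at each j the inner edge exactly when its coordinate is
   nonzero. *)
have [M pM MP] := perfect_matching_octant k (fun j => inner y k j != 0).
exists M => // c yc; move: yc; elim/(@cornerP k): c => j; have [m1 m2] := MP j => //.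
- move=> oj; move: m2; case: (h j) => [/eqP|->]; last by rewrite eqxx.
  by rewrite (negbTE oj).
- by rewrite -[y _]/(inner y k j) => ij; rewrite ij in m2.
- by rewrite -[y _]/(inner y (~~ k) j) i0 eqxx.
Qed.

Lemma distribute_barycentric (y : Y) :
  barycentric (perfect_matching_complex honeycomb222) (distribute (set_val y)).
Proof.
have [y0 yn _] := set_valP y; apply/realizationP; split.
- by move=> e; exact: distribute_ge0.
- by apply: distribute_sum; exact: total_gt0.
- have [M pM MP] := cone_matching (set_valP y).
  by exists M => //; exact: distribute_support.
Qed.

Definition to_cone (x : X) : Y := set_elt (separate_collect_cone x).

Definition from_cone (y : Y) : X := set_elt (distribute_barycentric y).

Lemma to_cone_continuous : continuous to_cone.
Proof.
move=> x; apply: continuous_at_set_type; apply: continuous_at_ptws => c.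
have cc d : continuous_at x (fun x : X => collect (set_val x) d).
  by apply: continuous_at_sum => e; exact: continuous_at_set_val_eval.
have cm j : continuous_at x (fun x : X => common (collect (set_val x)) j).
  by apply: continuous_at_min; exact: cc.
change (continuous_at x (fun x : X => separate (collect (set_val x)) c)).
rewrite /separate; case: c.1; apply: continuous_at_add => //.
  exact: continuous_at_opp.
by apply: continuous_at_sum => i; exact: cm.
Qed.

Lemma from_cone_continuous : continuous from_cone.
Proof.
move=> y; apply: continuous_at_set_type; apply: continuous_at_ptws => e.
apply: continuous_at_mul.
  by apply: continuous_at_sum => c; exact: continuous_at_set_val_eval.
apply: continuous_at_inv.
  by have [y0 yn _] := set_valP y; rewrite gt_eqF // total_gt0.
by apply: continuous_at_sum => c; exact: continuous_at_set_val_eval.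
Qed.

Lemma collect_distribute y c : collect (distribute y) c = y c / \sum_d y d.
Proof.
rewrite /collect /distribute -mulr_suml; congr (_ / _).
rewrite (exchange_big_dep xpredT) //= (bigD1 c) //= [X in _ + X]big1 => [|d dc].
  rewrite addr0 (big_pred1 (corner_edge c)) // => e /=.
  by apply/andP/eqP => [[_ /eqP]//|->]; rewrite corner_edgeK !eqxx.
apply: big1 => e /andP[/eqP ec /eqP de].
by move: dc; rewrite -ec -de corner_edgeK eqxx.
Qed.

(** A perfect matching supporting a point also supports its round trip, so the segment between them
    stays in one simplex. *)
Lemma from_to_cone_homotopic : globally_homotopic R (from_cone \o to_cone) idfun.
Proof.
pose f (x : X) := set_val (from_cone (to_cone x)).
apply: (@globally_homotopic_into_set R X _ (@barycentric R _ (perfect_matching_complex honeycomb222))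
  (from_cone \o to_cone) idfun
  (fun (x : X) t => (fun e => (1 - t) * f x e + t * set_val x e) : {ptws edge G -> R})).
- move=> x t /andP[t0 t1].
  have /realizationP[f0 f1 _] := set_valP (from_cone (to_cone x)).
  have /realizationP[x0 x1 [M pM xM]] := set_valP x.
  have s0 : 0 <= 1 - t by rewrite subr_ge0.
  apply/realizationP; split.
  + move=> e; apply: addr_ge0; apply: mulr_ge0 => //; first exact: f0.
    exact: x0.
  + by rewrite big_split /= -!mulr_sumr f1 x1 !mulr1 subrK.
  + exists M => // e; apply: contra_neqT => eM.
    have -> : set_val x e = 0 by apply/eqP; apply: contraNT eM; exact: xM.
    rewrite mulr0 addr0; apply/eqP; rewrite mulf_eq0; apply/orP; right.
    apply: contraNT eM; apply: distribute_support => c.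
    exact: separate_collect_support.
- apply: continuous_line => e x; last exact: continuous_at_set_val_eval.
  apply: (@continuous_at_comp _ _ _ (fun x : X => from_cone (to_cone x))
    (fun x : X => set_val x e)); last exact: continuous_at_set_val_eval.
  by apply: continuous_at_comp; [exact: to_cone_continuous|exact: from_cone_continuous].
- by move=> x; apply/funext => e; rewrite subr0 mul1r mul0r addr0.
- by move=> x; apply/funext => e; rewrite subrr mul0r mul1r add0r.
Qed.

(** On a side one of any two opposite inner corners vanishes, so [separate] does nothing and the
    round trip only rescales. The segment back to y therefore stays on the ray of y. *)
Lemma to_from_coneE (y : Y) c :
  set_val (to_cone (from_cone y)) c = set_val y c / \sum_d set_val y d.
Proof.
have [y0 yn [k [i0 _]]] := set_valP y.
rewrite -collect_distribute; transitivity (separate (collect (distribute (set_val y))) c) => //.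
rewrite separate_id // => j; apply/eqP/negPn/negP => cj.
have := common_neq0 (~~ k) (fun c => collect_ge0 c (fun e => distribute_ge0 e y0)) cj.
rewrite /inner collect_distribute; move: (i0 j); rewrite /inner => ->.
by rewrite mul0r eqxx.
Qed.

Lemma to_from_cone_homotopic : globally_homotopic R (to_cone \o from_cone) idfun.
Proof.
pose f (y : Y) := set_val (to_cone (from_cone y)).
apply: (@globally_homotopic_into_set R Y _ (@octahedral_cone R) (to_cone \o from_cone) idfun
  (fun (y : Y) t => (fun c => (1 - t) * f y c + t * set_val y c) : {ptws corner -> R})).
- move=> y t t01; have [y0 yn [k yk]] := set_valP y.
  have [f0 fn _] := set_valP (to_cone (from_cone y)).
  apply: (@cone_convex _ _ _ k) => //; apply: side_support yk => c yc.
  have y0c : set_val y c = 0 by [].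
  by rewrite /f to_from_coneE y0c mul0r !mulr0 addr0.
- apply: continuous_line => c y; last exact: continuous_at_set_val_eval.
  apply: (@continuous_at_comp _ _ _ (fun y : Y => to_cone (from_cone y))
    (fun y : Y => set_val y c)); last exact: continuous_at_set_val_eval.
  by apply: continuous_at_comp; [exact: from_cone_continuous|exact: to_cone_continuous].
- by move=> y; apply/funext => c; rewrite subr0 mul1r mul0r addr0.
- by move=> y; apply/funext => c; rewrite subrr mul0r mul1r add0r.
Qed.

Lemma realization_cone_equivalent :
  globally_homotopy_equivalent R X (Y : topologicalType).
Proof.
exists to_cone, from_cone; split.
- exact: to_cone_continuous.
- exact: from_cone_continuous.
- exact: from_to_cone_homotopic.
- exact: to_from_cone_homotopic.
Qed.

End ComplexCone.

Theorem theorem4p2 (R : realType) :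
  homotopy_equivalent R
    (realization R (perfect_matching_complex honeycomb222))
    (sphere_wedge R 3).
Proof.
apply: globally_homotopy_equivalentW.
apply: globally_homotopy_equivalent_trans (realization_cone_equivalent R) _.
exact: cone_wedge_equivalent.
Qed.
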